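(* For all $\tau\in\mathbb{H}$: (1) $g(\tau)^5-g(5\tau)-5g(\tau)g(5\tau)P(g(\tau),g(5\tau))=25g(\tau)^2g(5\tau)^2Q(g(\tau),g(5\tau))$, where $P(X,Y)=Y+11X^3-12X^2+7X-2$ and $Q(X,Y)=25X^2Y^3-5X(10X-1)Y^2+(35X^2-10X+1)Y-12X^2+7X-2$; (2) $U(\tau)^5-U(5\tau)=5U(\tau)U(5\tau)R(U(\tau),U(5\tau))$, where $R(X,Y)=(5Y^4-5Y^2+1)X^3-Y(5Y^2-3)X^2+(3Y^2-1)X-Y$.
   Context: $q=e^{2\pi i\tau}$, $q^r=e^{2\pi i r\tau}$ for rational $r$, $(a;q)_\infty=\prod_{k\ge0}(1-aq^k)$, $\eta(\tau)=q^{1/24}(q;q)_\infty$. $g(\tau)=\dfrac{\eta^2(2\tau)\eta^4(5\tau)}{\eta^4(\tau)\eta^2(10\tau)}$. $U(\tau)=I(\tau)/J(\tau)$ where $I(\tau)=q^{3/4}\dfrac{(q;q^{10})_\infty(q^9;q^{10})_\infty}{(q^4;q^{10})_\infty(q^6;q^{10})_\infty}$ and $J(\tau)=q^{1/4}\dfrac{(q^2;q^{10})_\infty(q^8;q^{10})_\infty}{(q^3;q^{10})_\infty(q^7;q^{10})_\infty}$. *)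

(* Defs.v *)
From Stdlib Require Import Reals ClassicalEpsilon.
From Coquelicot Require Import Coquelicot.

Local Open Scope C_scope.

Definition cexp (z : C) : C :=
  (exp (Re z) * cos (Im z), exp (Re z) * sin (Im z))%R.

Definition ci : C := (0%R, 1%R).

Definition qpow (r : R) (tau : C) : C := cexp (RtoC (2 * PI * r) * ci * tau).

Fixpoint qpoch_fin (a q : C) (n : nat) : C :=
  match n with
  | O => 1
  | S m => qpoch_fin a q m * (1 - a * Cpow q m)
  end.

(* (a;q)_infty : the limit of the partial products (a chosen limit; the
   partial products converge when |q| < 1, which is the only case used). *)
Definition qpoch_inf (a q : C) : C :=
  epsilon (inhabits (RtoC 0))
    (fun L => filterlim (qpoch_fin a q) eventually (locally L)).

Definition eta (tau : C) : C :=
  qpow (1/24) tau * qpoch_inf (qpow 1 tau) (qpow 1 tau).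

Definition g (tau : C) : C :=
  (Cpow (eta (RtoC 2 * tau)) 2 * Cpow (eta (RtoC 5 * tau)) 4)
  / (Cpow (eta tau) 4 * Cpow (eta (RtoC 10 * tau)) 2).

Definition I_fun (tau : C) : C :=
  qpow (3/4) tau *
  (qpoch_inf (qpow 1 tau) (qpow 10 tau) * qpoch_inf (qpow 9 tau) (qpow 10 tau))
  / (qpoch_inf (qpow 4 tau) (qpow 10 tau) * qpoch_inf (qpow 6 tau) (qpow 10 tau)).

Definition J_fun (tau : C) : C :=
  qpow (1/4) tau *
  (qpoch_inf (qpow 2 tau) (qpow 10 tau) * qpoch_inf (qpow 8 tau) (qpow 10 tau))
  / (qpoch_inf (qpow 3 tau) (qpow 10 tau) * qpoch_inf (qpow 7 tau) (qpow 10 tau)).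

Definition U (tau : C) : C := I_fun tau / J_fun tau.

Definition polyP (X Y : C) : C :=
  Y + RtoC 11 * Cpow X 3 - RtoC 12 * Cpow X 2 + RtoC 7 * X - RtoC 2.

Definition polyQ (X Y : C) : C :=
  RtoC 25 * Cpow X 2 * Cpow Y 3
  - RtoC 5 * X * (RtoC 10 * X - 1) * Cpow Y 2
  + (RtoC 35 * Cpow X 2 - RtoC 10 * X + 1) * Y
  - RtoC 12 * Cpow X 2 + RtoC 7 * X - RtoC 2.

Definition polyR (X Y : C) : C :=
  (RtoC 5 * Cpow Y 4 - RtoC 5 * Cpow Y 2 + 1) * Cpow X 3
  - Y * (RtoC 5 * Cpow Y 2 - RtoC 3) * Cpow X 2
  + (RtoC 3 * Cpow Y 2 - 1) * X - Y.

(* Main.v *)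
(** Everything reduces to the Rogers-Ramanujan continued fraction R and Ramanujan's
    parameter [k = q R(q) R(q^2)^2].  The Jacobi triple product turns theta functions into
    products; the three-term theta relation in base [q^10] gives
    [R(q)^2 / R(q^2) = (1-k)/(1+k)] and [U^2 = k/(1+k-k^2)], and the quintuple product gives the
    5-dissection [(q;q) = (q^25;q^25) (1/R(q^5) - q - q^2 R(q^5))].

    Multiplying the dissection over the conjugates [zeta^j q^(1/5)] expresses
    [(q;q)^6/(q^5;q^5)^6] by [R(q)^5], hence by [k]; this yields [g = (1-k^2)/(1-4k-k^2)], so that
    [g = (1-U^2)/(1-5U^2)].  Applied directly, the dissection gives
    [U(tau) U(5 tau) = (1/r-1-r)/(1/s-1-s)^2] with [r = q R(q^5)] and [s = q^2 R(q^10)].  As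
    [r^5 = k((1-k)/(1+k))^2] for [k] taken at [5 tau], the relation (2) becomes an identity in the
    field Q(k)(r); and (1) is the square of (2) after the Moebius substitution. *)

From HB Require Import structures.
From mathcomp Require Import all_boot.
From Stdlib Require Import Reals Lra Lia ZArith ClassicalEpsilon Classical.
From Coquelicot Require Import Coquelicot.
Require Import Defs.
Set Implicit Arguments. Unset Strict Implicit. Unset Printing Implicit Defensive.
Local Open Scope C_scope.

(** * The complex exponential and convergent sequences *)

(** No theory of modular forms enters. The theta identities come from rearranging absolutely
    convergent series over Z and Z^2, hence summation along the net of finite subsets. Functions of
    q are written through a logarithm [w] with q = [cexp w], so that q^(1/2), q^(1/5), q^(1/24) need
    no choice of root and a sign is a shift by [ipi].

    The obstacle is the factor q^(1/2) in [U]: only U^2 is a rational function of k. With X = U(tau)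
    and Y = U(5 tau), relation (2) sorted by parity reads X A(X^2, Y^2) = Y B(X^2, Y^2). Multiplied
    by Y it involves only X Y and Y^2, where the half-integral powers are gone; squared it relates
    X^2 and Y^2, which is what (1) needs, since g depends on U^2 alone.

    Identities in Q(k)(r) are checked in the basis 1, r, ..., r^4, where each becomes five
    identities between rational functions of k. *)

Lemma cexp_add (z w : C) : cexp (z + w) = cexp z * cexp w.
Proof.
rewrite /cexp /Cmult /Re /Im /= exp_plus cos_plus sin_plus; congr (_, _); ring.
Qed.

Lemma cexp_0 : cexp 0 = 1.
Proof. by rewrite /cexp /= exp_0 cos_0 sin_0 !Rmult_1_l. Qed.

Lemma Cmod_cexp (z : C) : Cmod (cexp z) = exp (Re z).
Proof.
rewrite /Cmod /cexp /=.
have -> : (exp (fst z) * cos (snd z) * (exp (fst z) * cos (snd z) * 1) +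
  exp (fst z) * sin (snd z) * (exp (fst z) * sin (snd z) * 1)
  = exp (fst z) * exp (fst z) * (Rsqr (sin (snd z)) + Rsqr (cos (snd z))))%R.
  rewrite /Rsqr; ring.
rewrite sin2_cos2 Rmult_1_r sqrt_square //; left; exact: exp_pos.
Qed.

Lemma cexp_neq0 (z : C) : cexp z <> 0.
Proof. apply/Cmod_gt_0; rewrite Cmod_cexp; exact: exp_pos. Qed.

Lemma cexp_opp (z : C) : cexp (- z) = / cexp z.
Proof.
have H : cexp (- z) * cexp z = 1 by rewrite -cexp_add -[RHS]cexp_0; congr cexp; ring.
rewrite -(Cmult_1_l (/ cexp z)) -H; field; exact: cexp_neq0.
Qed.

Lemma cexp_mult_nat (n : nat) (z : C) : cexp (INR n * z) = Cpow (cexp z) n.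
Proof.
elim: n => [|n IH]; first by rewrite /= Cmult_0_l cexp_0.
rewrite S_INR RtoC_plus Cmult_plus_distr_r cexp_add IH Cmult_1_l /=; ring.
Qed.

Definition ipi : C := RtoC PI * ci.

Lemma cexp_ipi : cexp ipi = - (1).
Proof.
rewrite /cexp /ipi /ci /= !Rmult_0_l !Rmult_0_r !Rmult_1_r Rminus_0_r Rplus_0_r.
rewrite exp_0 cos_PI sin_PI /Copp /=; congr (_, _); ring.
Qed.

Lemma cexp_2ipi : cexp (2 * ipi) = 1.
Proof.
have -> : RtoC 2 * ipi = ipi + ipi by ring.
rewrite cexp_add cexp_ipi; ring.
Qed.

Lemma cexp_2ipi_Z (n : Z) : cexp (RtoC (IZR n) * (2 * ipi)) = 1.
Proof.
have Hn (m : nat) : cexp (INR m * (2 * ipi)) = 1.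
  rewrite cexp_mult_nat cexp_2ipi; elim: m => //= m ->; ring.
case: (Z_le_gt_dec 0 n) => Hz.
  by rewrite -(Z2Nat.id n Hz) -INR_IZR_INZ.
have -> : RtoC (IZR n) * (2 * ipi) = - (INR (Z.to_nat (- n)) * (2 * ipi)).
  rewrite INR_IZR_INZ Z2Nat.id; last lia.
  rewrite opp_IZR RtoC_opp; ring.
rewrite cexp_opp Hn; field.
Qed.

Definition Ccv (u : nat -> C) (L : C) : Prop :=
  forall e : R, (0 < e)%R ->
  exists N, forall n, (N <= n)%coq_nat -> (Cmod (u n - L) < e)%R.

Lemma Ccv_filterlim (u : nat -> C) (L : C) :
  filterlim u eventually (locally L) <-> Ccv u L.
Proof.
split => [H e He|H P /locally_C [e He]].
  have /H [N HN] : locally (T := C_UniformSpace) L (fun z => Cmod (z - L) < e)%R.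
    apply/locally_C; exists (mkposreal e He) => z; exact.
  by exists N.
have [N HN] := H e (cond_pos e).
exists N => n Hn; apply: He; exact: HN.
Qed.

Lemma Cmod_small_0 (z : C) : (forall e : R, (0 < e)%R -> (Cmod z < e)%R) -> z = 0.
Proof.
move=> H; apply: Cmod_eq_0; case: (Rle_lt_or_eq_dec _ _ (Cmod_ge_0 z)) => [/H h|<-] //; lra.
Qed.

Lemma Csub_eq0 (x y : C) : x - y = 0 -> x = y.
Proof. by move=> E; have -> : x = (x - y) + y by [ring]; rewrite E Cplus_0_l. Qed.

Lemma Cmod_sub_trans (x y z : C) : (Cmod (x - z) <= Cmod (x - y) + Cmod (y - z))%R.
Proof. have -> : x - z = (x - y) + (y - z) by ring. exact: Cmod_triangle. Qed.

Lemma Cmod_subC (x y : C) : Cmod (x - y) = Cmod (y - x).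
Proof. have -> : x - y = - (y - x) by ring. exact: Cmod_opp. Qed.

Lemma Ccv_unique (u : nat -> C) (L M : C) : Ccv u L -> Ccv u M -> L = M.
Proof.
move=> HL HM; apply: Csub_eq0.
apply: Cmod_small_0 => e He.
have [N1 H1] := HL (e / 2)%R ltac:(lra); have [N2 H2] := HM (e / 2)%R ltac:(lra).
have {}H1 := H1 (N1 + N2)%coq_nat ltac:(lia); have {}H2 := H2 (N1 + N2)%coq_nat ltac:(lia).
have := Cmod_sub_trans L (u (N1 + N2)%coq_nat) M; rewrite (Cmod_subC L (u _)); lra.
Qed.

Lemma Ccv_ext_ge (u v : nat -> C) (L : C) (N : nat) :
  (forall n, (N <= n)%coq_nat -> u n = v n) -> Ccv u L -> Ccv v L.
Proof.
move=> E H e /H [M HM]; exists (N + M)%coq_nat => n Hn.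
rewrite -E; [apply: HM|]; lia.
Qed.

Lemma Ccv_ext (u v : nat -> C) (L : C) : (forall n, u n = v n) -> Ccv u L -> Ccv v L.
Proof. by move=> E; apply: (@Ccv_ext_ge _ _ _ 0). Qed.

Lemma Ccv_subseq (u : nat -> C) (L : C) (s : nat -> nat) :
  (forall M, exists N, forall n, (N <= n)%coq_nat -> (M <= s n)%coq_nat) ->
  Ccv u L -> Ccv (fun n => u (s n)) L.
Proof.
move=> Hs H e /H [M HM]; have [N HN] := Hs M.
by exists N => n Hn; apply: HM; apply: HN.
Qed.

Lemma Ccv_const (c : C) : Ccv (fun _ => c) c.
Proof. by move=> e He; exists O => n _; rewrite /Cminus Cplus_opp_r Cmod_0. Qed.

Lemma Ccv_mult (u v : nat -> C) (L M : C) :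
  Ccv u L -> Ccv v M -> Ccv (fun n => u n * v n) (L * M).
Proof.
move=> Hu Hv e He.
set K := (Cmod M + Cmod L + 2)%R.
have K1 : (2 <= K)%R by move: (Cmod_ge_0 M) (Cmod_ge_0 L); rewrite /K; lra.
have He2 : (0 < Rmin 1 (e / K))%R.
  apply: Rmin_pos; first lra. apply: Rdiv_lt_0_compat; lra.
have [N1 H1] := Hu _ He2; have [N2 H2] := Hv _ He2.
exists (N1 + N2)%coq_nat => n Hn.
have {}H1 := H1 n ltac:(lia); have {}H2 := H2 n ltac:(lia).
have -> : u n * v n - L * M = (u n - L) * (v n - M) + (u n - L) * M + L * (v n - M) by ring.
have T := Cmod_triangle ((u n - L) * (v n - M) + (u n - L) * M) (L * (v n - M)).
have T2 := Cmod_triangle ((u n - L) * (v n - M)) ((u n - L) * M).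
rewrite !Cmod_mult in T T2.
set d := Rmin 1 (e / K) in He2 H1 H2.
have d1 : (d <= 1)%R := Rmin_l _ _.
have d2 : (d * K <= e)%R.
  have := Rmin_r 1 (e / K); rewrite -/d => h.
  apply: (Rle_trans _ (e / K * K)); last by right; field; lra.
  apply: Rmult_le_compat_r; lra.
move: (Cmod_ge_0 (u n - L)) (Cmod_ge_0 (v n - M)) (Cmod_ge_0 M) (Cmod_ge_0 L) => a0 b0 c0 f0.
have e1 : (Cmod (u n - L) * Cmod (v n - M) <= d * 1)%R.
  apply: Rmult_le_compat; lra.
have e2 : (Cmod (u n - L) * Cmod M <= d * Cmod M)%R by apply: Rmult_le_compat_r; lra.
have e3 : (Cmod L * Cmod (v n - M) <= Cmod L * d)%R by apply: Rmult_le_compat_l; lra.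
have : (d * K = d * Cmod M + Cmod L * d + d*2)%R by rewrite /K; ring.
lra.
Qed.

Lemma Ccv_inv (u : nat -> C) (L : C) : L <> 0 -> Ccv u L -> Ccv (fun n => / u n) (/ L).
Proof.
move=> L0 Hu e He; have Lp : (0 < Cmod L)%R by apply/Cmod_gt_0.
set l := Cmod L in Lp *.
have He2 : (0 < Rmin (l / 2) (e * l * l / 2))%R.
  apply: Rmin_pos; first lra. 
  have : (0 < e * l * l)%R by apply: Rmult_lt_0_compat => //; apply: Rmult_lt_0_compat.
  lra.
have [N H] := Hu _ He2; exists N => n /H {}H.
set d := Rmin _ _ in H He2.
have d1 : (d <= l / 2)%R := Rmin_l _ _.
have d2 : (d <= e * l * l / 2)%R := Rmin_r _ _.
have hl : (l / 2 < Cmod (u n))%R.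
  have := Cmod_triangle (u n) (L - u n).
  have -> : u n + (L - u n) = L by ring.
  rewrite -/l Cmod_subC; lra.
have un0 : u n <> 0 by apply/Cmod_gt_0; lra.
have -> : / u n - / L = (L - u n) / (u n * L) by field.
rewrite Cmod_div; last exact: Cmult_neq_0.
rewrite Cmod_mult Cmod_subC -/l.
apply: (Rmult_lt_reg_r (Cmod (u n) * l)); first by apply: Rmult_lt_0_compat; lra.
have -> : (Cmod (u n - L) / (Cmod (u n) * l) * (Cmod (u n) * l) = Cmod (u n - L))%R.
  field; lra.
apply: (Rlt_le_trans _ d) => //; apply: (Rle_trans _ _ _ d2).
have -> : (e * l * l / 2 = e * ((l / 2) * l))%R by field.
apply: Rmult_le_compat_l; first lra.
apply: Rmult_le_compat_r; lra.
Qed.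

(** * Unconditional summation *)

HB.instance Definition _ :=
  Monoid.isComLaw.Build C (RtoC 0) Cplus Cplus_assoc Cplus_comm Cplus_0_l.

Lemma Rplus_associative : associative Rplus.
Proof. by move=> x y z; rewrite Rplus_assoc. Qed.

HB.instance Definition _ :=
  Monoid.isComLaw.Build R 0%R Rplus Rplus_associative Rplus_comm Rplus_0_l.

Notation Csum s f := (\big[Cplus/RtoC 0]_(i <- s) f i).
Notation Rsum s f := (\big[Rplus/0%R]_(i <- s) f i).

Section FiniteSums.
Variable I : eqType.
Implicit Types (s t : seq I).

Lemma Rsum_le (f h : I -> R) s :
  (forall i, i \in s -> (f i <= h i)%R) -> (Rsum s f <= Rsum s h)%R.
Proof.
elim: s => [|x s IH] H; first by rewrite !big_nil; right.
rewrite !big_cons; apply: Rplus_le_compat; first by apply: H; rewrite mem_head.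
by apply: IH => i Hi; apply: H; rewrite in_cons Hi orbT.
Qed.

Lemma Rsum_ge0 (f : I -> R) s : (forall i, (0 <= f i)%R) -> (0 <= Rsum s f)%R.
Proof. by move=> H; apply: (big_ind (fun x => (0 <= x)%R)) => [|x y|//]; [right|apply: Rplus_le_le_0_compat]. Qed.

Lemma Rsum_const (c : R) s : Rsum s (fun=> c) = (INR (size s) * c)%R.
Proof.
elim: s => [|x s IH]; first by rewrite big_nil /=; ring.
by rewrite big_cons IH -[size (x :: s)]/(S (size s)) S_INR; ring.
Qed.

Lemma Cmod_Csum (f : I -> C) s : (Cmod (Csum s f) <= Rsum s (fun i => Cmod (f i)))%R.
Proof.
elim: s => [|x s IH]; first by rewrite !big_nil Cmod_0; right.
rewrite !big_cons; apply: (Rle_trans _ _ _ (Cmod_triangle _ _)).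
exact: Rplus_le_compat_l.
Qed.

Lemma Csum_minus (f h : I -> C) s : Csum s f - Csum s h = Csum s (fun i => f i - h i).
Proof. elim: s => [|x s IH]; rewrite ?big_nil ?big_cons -?IH; ring. Qed.

Lemma Csum_scal (c : C) (f : I -> C) s : c * Csum s f = Csum s (fun i => c * f i).
Proof. elim: s => [|x s IH]; rewrite ?big_nil ?big_cons -?IH; ring. Qed.

Lemma Csum_RtoC (f : I -> R) s : Csum s (fun i => RtoC (f i)) = RtoC (Rsum s f).
Proof. by elim: s => [|x s IH]; rewrite ?big_nil // !big_cons IH RtoC_plus. Qed.

Lemma perm_cat_filter s t : uniq s -> uniq t -> {subset s <= t} ->
  perm_eq t (s ++ [seq i <- t | i \notin s]).
Proof.
move=> us ut st; apply: uniq_perm => //.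
  rewrite cat_uniq us filter_uniq // andbT; apply/hasPn => i.
  by rewrite mem_filter => /andP[].
move=> i; rewrite mem_cat mem_filter; case: (boolP (i \in s)) => //= /st //.
Qed.

Lemma Rsum_subset (f : I -> R) s t : (forall i, (0 <= f i)%R) ->
  uniq s -> uniq t -> {subset s <= t} -> (Rsum s f <= Rsum t f)%R.
Proof.
move=> H us ut st; rewrite [X in (_ <= X)%R](perm_big _ (perm_cat_filter us ut st)) big_cat /=.
have := Rsum_ge0 [seq i <- t | i \notin s] H; lra.
Qed.

End FiniteSums.

(* Convergence along the net of finite subsets of [I]. *)
Definition hassum (I : eqType) (f : I -> C) (L : C) : Prop :=
  forall e : R, (0 < e)%R -> exists s0 : seq I, forall s,
  uniq s -> {subset s0 <= s} -> (Cmod (Csum s f - L) < e)%R.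

Definition abs_summable (I : eqType) (f : I -> C) : Prop :=
  exists M : R, forall s : seq I, uniq s -> (Rsum s (fun i => Cmod (f i)) <= M)%R.

Section HasSum.
Variable I : eqType.
Implicit Types (f h : I -> C) (s t : seq I).

Lemma hassum_unique f (L M : C) : hassum f L -> hassum f M -> L = M.
Proof.
move=> HL HM; apply: Csub_eq0.
apply: Cmod_small_0 => e He.
have [s1 H1] := HL (e / 2)%R ltac:(lra); have [s2 H2] := HM (e / 2)%R ltac:(lra).
pose s := undup (s1 ++ s2).
have us : uniq s by exact: undup_uniq.
have {}H1 := H1 s us ltac:(by move=> i Hi; rewrite mem_undup mem_cat Hi).
have {}H2 := H2 s us ltac:(by move=> i Hi; rewrite mem_undup mem_cat Hi orbT).
have := Cmod_sub_trans L (Csum s f) M; rewrite (Cmod_subC L (Csum s f)); lra.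
Qed.

Lemma hassum_ext f h (L : C) : (forall i, f i = h i) -> hassum f L -> hassum h L.
Proof.
move=> E H e /H [s0 Hs]; exists s0 => s us ss.
have -> : Csum s h = Csum s f by apply: eq_bigr. 
  exact: Hs.
Qed.

Lemma hassum_plus f h (L M : C) :
  hassum f L -> hassum h M -> hassum (fun i => f i + h i) (L + M).
Proof.
move=> HL HM e He.
have [s1 H1] := HL (e / 2)%R ltac:(lra); have [s2 H2] := HM (e / 2)%R ltac:(lra).
exists (s1 ++ s2) => s us ss.
have {}H1 := H1 s us ltac:(by move=> i Hi; apply: ss; rewrite mem_cat Hi).
have {}H2 := H2 s us ltac:(by move=> i Hi; apply: ss; rewrite mem_cat Hi orbT).
rewrite big_split /=.
have -> : Csum s f + Csum s h - (L + M) = (Csum s f - L) + (Csum s h - M) by ring.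
have := Cmod_triangle (Csum s f - L) (Csum s h - M); lra.
Qed.

Lemma hassum_scal (c : C) f (L : C) : hassum f L -> hassum (fun i => c * f i) (c * L).
Proof.
move=> HL e He.
have [c0|c0] := Ceq_dec c 0.
  exists [::] => s _ _; rewrite -Csum_scal c0 !Cmult_0_l.
  by rewrite /Cminus Cplus_opp_r Cmod_0.
have cp : (0 < Cmod c)%R by apply/Cmod_gt_0.
have [s0 H] := HL (e / Cmod c)%R (Rdiv_lt_0_compat _ _ He cp).
exists s0 => s us ss; rewrite -Csum_scal.
have -> : c * Csum s f - c * L = c * (Csum s f - L) by ring.
rewrite Cmod_mult; have {H} := Rmult_lt_compat_l _ _ _ cp (H s us ss).
have -> : (Cmod c * (e / Cmod c) = e)%R by field; lra.
done.
Qed.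

Lemma hassum_finite_support f s0 : uniq s0 ->
  (forall i, i \notin s0 -> f i = 0) -> hassum f (Csum s0 f).
Proof.
move=> u0 H e He; exists s0 => s us ss.
rewrite [in X in Csum s X]/= (perm_big _ (perm_cat_filter u0 us ss)) big_cat /=.
rewrite [X in _ + X]big_seq [X in _ + X]big1 => [|i].
  by rewrite Cplus_0_r /Cminus Cplus_opp_r Cmod_0.
by rewrite mem_filter => /andP[/H].
Qed.

(** For nonnegative terms the net of finite sums is monotone, so its supremum is its limit. *)
Lemma hassum_nonneg (f : I -> R) (M : R) : (forall i, (0 <= f i)%R) ->
  (forall s, uniq s -> (Rsum s f <= M)%R) -> exists L, hassum (fun i => RtoC (f i)) L.
Proof.
move=> f0 fM.
pose E x := exists s : seq I, uniq s /\ x = Rsum s f.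
have [L [ub lub]] : {L | is_lub E L}.
  apply: completeness; first by exists M => x [s [us ->]]; apply: fM.
  by exists (Rsum [::] f), [::].
exists (RtoC L) => e He.
have [s0 [u0 H0]] : exists s0, uniq s0 /\ (L - e < Rsum s0 f)%R.
  apply: NNPP => HN; suff : (L <= L - e)%R by lra.
  apply: lub => x [s [us ->]]; apply: Rnot_lt_le => h; apply: HN; by exists s.
exists s0 => s us ss; rewrite Csum_RtoC -RtoC_minus Cmod_R.
have h1 : (Rsum s f <= L)%R by apply: ub; exists s.
have h2 := Rsum_subset f0 u0 us ss.
by apply: Rabs_def1; lra.
Qed.

(** A real family [k] with |k| <= |f| is the difference of the bounded nonnegative families |f| + k
    and |f|; this is applied to the real and imaginary parts. *)
Lemma abs_summable_ex f : abs_summable f -> exists L, hassum f L.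
Proof.
move=> [M HM].
have key (k : I -> R) : (forall i, (Rabs (k i) <= Cmod (f i))%R) ->
    exists L, hassum (fun i => RtoC (k i)) L.
  move=> Hk.
  have [L1 H1] : exists L, hassum (fun i => RtoC (Cmod (f i))) L.
    by apply: (hassum_nonneg (M := M)) => // i; apply: Cmod_ge_0.
  have [L2 H2] : exists L, hassum (fun i => RtoC (Cmod (f i) + k i)) L.
    apply: (hassum_nonneg (M := (M + M)%R)) => [i|s us].
      move: (Hk i); rewrite -Rabs_Ropp; have := Rle_abs (- k i); lra.
    have h := HM s us; apply: (Rle_trans _ (Rsum s (fun i => Cmod (f i)) + Rsum s (fun i => Cmod (f i)))%R); last lra.
    rewrite -big_split /=; apply: Rsum_le => i _; move: (Hk i) (Rle_abs (k i)); lra.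
  exists (L2 + (- (1)) * L1); apply: hassum_ext (hassum_plus H2 (hassum_scal (- (1)) H1)) => i.
  rewrite RtoC_plus; ring.
have [L1 H1] := key (fun i => Re (f i)) (fun i => Rle_trans _ _ _ (Rmax_l _ _) (Rmax_Cmod (f i))).
have [L2 H2] := key (fun i => Im (f i)) (fun i => Rle_trans _ _ _ (Rmax_r _ _) (Rmax_Cmod (f i))).
exists (L1 + ci * L2); apply: hassum_ext (hassum_plus H1 (hassum_scal ci H2)) => i.
case: (f i) => x y; rewrite /ci /Cplus /Cmult /RtoC /Re /Im /=; congr (_, _); ring.
Qed.

End HasSum.

Lemma hassum_reindex (I J : eqType) (phi : I -> J) (f : J -> C) (L : C) :
  injective phi -> (forall j, exists i, phi i = j) ->
  hassum f L -> hassum (fun i => f (phi i)) L.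
Proof.
move=> inj surj H e /H [s0 Hs].
have [psi Hpsi] := choice _ surj.
exists [seq psi j | j <- s0] => s us ss.
have -> : Csum s (fun i => f (phi i)) = Csum (map phi s) f by rewrite big_map.
apply: Hs; first by rewrite map_inj_uniq.
move=> j Hj; apply/mapP; exists (psi j) => //; apply: ss; exact: map_f.
Qed.

(** Summability of the whole family is a hypothesis, so it suffices to truncate finitely many rows,
    each closely enough to its sum and far enough for the union of the truncations to contain the
    set [s0] given by the total sum. *)
Lemma hassum_fubini (I J : eqType) (f : I * J -> C) (h : I -> C) (L : C) :
  (forall i, hassum (fun j => f (i, j)) (h i)) -> hassum f L -> hassum h L.
Proof.
move=> Hrow Hf e He.
have [s0 H0] := Hf (e / 2)%R ltac:(lra).
exists (map fst s0) => s us ss.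
(* With this tolerance the errors of the [size s] rows add up to at most e/2; the +1 covers an empty
   [s]. *)
pose d := (e / 2 / (INR (size s) + 1))%R.
have sz : (0 <= INR (size s))%R := pos_INR _.
have dp : (0 < d)%R by apply: Rdiv_lt_0_compat; lra.
have Ht i : exists t : seq J, uniq t /\ (forall j, (i, j) \in s0 -> j \in t) /\
    (Cmod (Csum t (fun j => f (i, j)) - h i) < d)%R.
  have [t1 Ht1] := Hrow i d dp.
  exists (undup (t1 ++ [seq x.2 | x <- s0])); split; first exact: undup_uniq.
  split; last by apply: Ht1 => [|j Hj]; rewrite ?undup_uniq // mem_undup mem_cat Hj.
  by move=> j Hj; rewrite mem_undup mem_cat; apply/orP; right; apply/mapP; exists (i, j).
have {Ht} [t Ht] := choice _ Ht.
pose S := [seq (i, j) | i <- s, j <- t i].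
have uS : uniq S.
  apply: allpairs_uniq_dep => // [i _|]; first by case: (Ht i).
  by move=> [i j] [i' j'] _ _ /= [-> ->].
have sS : {subset s0 <= S}.
  move=> [i j] Hij; apply/allpairsPdep; exists i, j; split=> //.
    by apply: ss; apply/mapP; exists (i, j).
  by case: (Ht i) => _ [H _]; apply: H.
have {}H0 := H0 S uS sS.
have ES : Csum S f = Csum s (fun i => Csum (t i) (fun j => f (i, j))).
  by rewrite big_allpairs_dep.
have T := Cmod_sub_trans (Csum s h) (Csum S f) L.
suff h1 : (Cmod (Csum s h - Csum S f) <= e / 2)%R.
  apply: Rle_lt_trans T _; have := Rplus_le_lt_compat _ _ _ _ h1 H0.
  by have -> : (e / 2 + e / 2 = e)%R by field.
rewrite ES Csum_minus; apply: (Rle_trans _ _ _ (Cmod_Csum _ _)).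
apply: (Rle_trans _ (Rsum s (fun=> d))).
  by apply: Rsum_le => i _; rewrite Cmod_subC; left; case: (Ht i) => _ [].
rewrite Rsum_const /d.
apply: (Rmult_le_reg_r (INR (size s) + 1)); first lra.
have -> : (INR (size s) * (e / 2 / (INR (size s) + 1)) * (INR (size s) + 1) = e / 2 * INR (size s))%R.
  field; lra.
apply: Rmult_le_compat_l; lra.
Qed.

(** A finite set of pairs lies in a finite rectangle, so the absolute sums are bounded by [M * N].
    The value of the sum is then found by summing along rows. *)
Lemma hassum_prod (I J : eqType) (f : I -> C) (h : J -> C) (a b : C) :
  abs_summable f -> abs_summable h -> hassum f a -> hassum h b ->
  hassum (fun x : I * J => f x.1 * h x.2) (a * b).
Proof.
move=> [M HM] [N HN] Ha Hb.
have [L HL] : exists L, hassum (fun x : I * J => f x.1 * h x.2) L.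
  apply: abs_summable_ex; exists (M * N)%R => s us.
  pose s1 := undup (map fst s); pose s2 := undup (map snd s).
  have u1 : uniq s1 by exact: undup_uniq.
  have u2 : uniq s2 by exact: undup_uniq.
  apply: (Rle_trans _ (Rsum [seq (i, j) | i <- s1, j <- s2] (fun x => Cmod (f x.1 * h x.2)))).
    apply: Rsum_subset => //; first by move=> i; apply: Cmod_ge_0.
      by apply: allpairs_uniq => // [[i j] [i' j'] _ _ /= [-> ->]].
    move=> [i j] Hij; apply: allpairs_f; rewrite mem_undup; apply/mapP; by exists (i, j).
  rewrite big_allpairs_dep /=.
  apply: (Rle_trans _ (Rsum s1 (fun i => Cmod (f i) * N)%R)).
    apply: Rsum_le => i _.
    apply: (Rle_trans _ (Cmod (f i) * Rsum s2 (fun j => Cmod (h j)))%R); last first.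
      by apply: Rmult_le_compat_l; [apply: Cmod_ge_0|apply: HN].
    right; elim: (s2) => [|j t IH]; rewrite ?big_nil ?big_cons /=; first ring.
    by rewrite IH Cmod_mult; ring.
  have -> : Rsum s1 (fun i => Cmod (f i) * N)%R = (Rsum s1 (fun i => Cmod (f i)) * N)%R.
    elim: (s1) => [|j t IH]; rewrite ?big_nil ?big_cons /= ?IH; ring.
  apply: Rmult_le_compat_r; last exact: HM.
  by have := HN [::] isT; rewrite big_nil.
suff -> : a * b = L by [].
apply: (hassum_unique (f := fun i => b * f i)); first by rewrite Cmult_comm; apply: hassum_scal.
apply: hassum_fubini HL => i /=; rewrite Cmult_comm; exact: hassum_scal.
Qed.

(** Cuts a series into [n] subseries by a change of index. All theta identities below come from it,
    with congruence classes of Z or Z^2 and n = 2, 3 or 5. *)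
Lemma hassum_partition (n : nat) (K J : eqType) (phi : 'I_n * K -> J) (f : J -> C)
    (h : 'I_n -> C) (L : C) :
  injective phi -> (forall j, exists i, phi i = j) ->
  (forall i, hassum (fun k => f (phi (i, k))) (h i)) ->
  hassum f L -> L = \big[Cplus/RtoC 0]_(i < n) h i.
Proof.
move=> inj surj Hh /(hassum_reindex inj surj) HL.
apply: (hassum_unique (hassum_fubini Hh HL)).
rewrite -big_enum /=; apply: hassum_finite_support; first exact: enum_uniq.
by move=> i; rewrite mem_enum.
Qed.

(** Tannery's theorem: outside one finite set [s] all the sums are uniformly small by domination,
    and on [s] convergence is termwise. *)
Lemma hassum_dominated (I : eqType) (u : nat -> I -> C) (f : I -> C) (d : I -> C)
    (Lu : nat -> C) (L : C) :
  abs_summable d -> (forall n i, (Cmod (u n i) <= Cmod (d i))%R) ->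
  (forall i, Ccv (fun n => u n i) (f i)) ->
  (forall n, hassum (u n) (Lu n)) -> hassum f L -> Ccv Lu L.
Proof.
move=> [M HM] ud uf Hu HL e He.
have [D HD] : exists D, hassum (fun i => RtoC (Cmod (d i))) D.
  by apply: (hassum_nonneg (M := M)) => // i; apply: Cmod_ge_0.
pose e5 := (e / 5)%R; have e5p : (0 < e5)%R by rewrite /e5; lra.
have [s1 H1] := HL e5 e5p; have [s2 H2] := HD (e5 / 2)%R ltac:(lra).
(* Any two finite sets containing [s2] have sums of |d| within [e5] of each other. So beyond [s]
   every [u n] contributes at most [e5], uniformly in [n]. *)
pose s := undup (s1 ++ s2); have us : uniq s by exact: undup_uniq.
have {}H1 := H1 s us ltac:(by move=> i Hi; rewrite mem_undup mem_cat Hi).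
have ss2 : {subset s2 <= s} by move=> i Hi; rewrite mem_undup mem_cat Hi orbT.
have tail n : (Cmod (Lu n - Csum s (u n)) <= 2 * e5)%R.
  have [s3 H3] := Hu n e5 e5p.
  pose t := undup (s ++ s3); have ut : uniq t by exact: undup_uniq.
  have st : {subset s <= t} by move=> i Hi; rewrite mem_undup mem_cat Hi.
  have {}H3 := H3 t ut ltac:(by move=> i Hi; rewrite mem_undup mem_cat Hi orbT).
  have P := perm_cat_filter us ut st.
  have h1 := H2 s us ss2; have h2 := H2 t ut (fun i h => st i (ss2 i h)).
  rewrite Csum_RtoC in h1; rewrite Csum_RtoC in h2.
  have h3 : (Rabs (Rsum t (fun i => Cmod (d i)) - Rsum s (fun i => Cmod (d i))) < e5)%R.
    rewrite -Cmod_R RtoC_minus.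
    have := Cmod_sub_trans (Rsum t (fun i => Cmod (d i))) D (Rsum s (fun i => Cmod (d i))).
    rewrite (Cmod_subC D); lra.
  have h4 : (Cmod (Csum t (u n) - Csum s (u n)) <= e5)%R.
    rewrite (perm_big _ P) big_cat /=.
    set r := [seq i <- t | i \notin s] in P *.
    have -> : Csum s (u n) + Csum r (u n) - Csum s (u n) = Csum r (u n) by ring.
    apply: (Rle_trans _ _ _ (Cmod_Csum _ _)).
    apply: (Rle_trans _ (Rsum r (fun i => Cmod (d i)))); first by apply: Rsum_le.
    move: h3; rewrite (perm_big _ P) big_cat /=.
    have K (A B : R) : (Rabs (A + B - A) < e5 -> B <= e5)%R.
      have := Rle_abs (A + B - A)%R; lra.
    exact: K.
  have := Cmod_sub_trans (Lu n) (Csum t (u n)) (Csum s (u n)).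
  rewrite (Cmod_subC (Lu n) (Csum t (u n))); lra.
have [N HN] : exists N, forall n, (N <= n)%coq_nat -> (Cmod (Csum s (u n) - Csum s f) < e5)%R.
  have : Ccv (fun n => Csum s (u n)) (Csum s f).
    elim: (s) => [|x r IH] e' He'.
      by exists O => n _; rewrite !big_nil /Cminus Cplus_opp_r Cmod_0.
    have [N1 G1] := IH (e' / 2)%R ltac:(lra); have [N2 G2] := uf x (e' / 2)%R ltac:(lra).
    exists (N1 + N2)%coq_nat => n Hn; rewrite !big_cons.
    have {}G1 := G1 n ltac:(lia); have {}G2 := G2 n ltac:(lia).
    have -> : u n x + Csum r (u n) - (f x + Csum r f) = (u n x - f x) + (Csum r (u n) - Csum r f) by ring.
    have := Cmod_triangle (u n x - f x) (Csum r (u n) - Csum r f); lra.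
  by apply.
exists N => n /HN {}HN.
have := Cmod_sub_trans (Lu n) (Csum s (u n)) L; have := tail n.
have := Cmod_sub_trans (Csum s (u n)) (Csum s f) L.
rewrite /e5 in H1 HN *; lra.
Qed.

(** * Infinite products *)

HB.instance Definition _ :=
  Monoid.isComLaw.Build C (RtoC 1) Cmult Cmult_assoc Cmult_comm Cmult_1_l.

Lemma Ccv_cauchy (u : nat -> C) :
  (forall e : R, (0 < e)%R -> exists N, forall n, (Cmod (u (N + n)%coq_nat - u N) < e)%R) ->
  exists L, Ccv u L.
Proof.
move=> H.
have key (k : C -> R) : (forall x y, (Rabs (k x - k y) <= Cmod (x - y))%R) ->
    exists l : R, is_lim_seq (fun n => k (u n)) l.
  move=> Hk.
  have [l Hl] : ex_finite_lim_seq (fun n => k (u n)); last by exists l.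
  apply/ex_lim_seq_cauchy_corr => e.
  have [N HN] := H (e / 2)%R ltac:(by move: (cond_pos e); lra).
  exists N => n m Hn Hm.
  apply: (Rle_lt_trans _ _ _ (Hk _ _)).
  have h1 := HN (Nat.sub n N); have h2 := HN (Nat.sub m N).
  have e1 : (N + (Nat.sub n N))%coq_nat = n by lia.
  have e2 : (N + (Nat.sub m N))%coq_nat = m by lia.
  rewrite e1 in h1; rewrite e2 in h2.
  have := Cmod_sub_trans (u n) (u N) (u m); rewrite (Cmod_subC (u N) (u m)); lra.
have [x Hx] := key Re (fun z w => Rle_trans _ _ _ (Rmax_l _ _) (Rmax_Cmod (z - w))).
have [y Hy] := key Im (fun z w => Rle_trans _ _ _ (Rmax_r _ _) (Rmax_Cmod (z - w))).
exists (x, y) => e He.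
have [N1 H1] : exists N, forall n, (N <= n)%coq_nat -> (Rabs (Re (u n) - x) < e / 2)%R.
  by move/is_lim_seq_spec: Hx => /(_ (mkposreal (e / 2) ltac:(lra))).
have [N2 H2] : exists N, forall n, (N <= n)%coq_nat -> (Rabs (Im (u n) - y) < e / 2)%R.
  by move/is_lim_seq_spec: Hy => /(_ (mkposreal (e / 2) ltac:(lra))).
exists (N1 + N2)%coq_nat => n Hn.
have {}H1 := H1 n ltac:(lia); have {}H2 := H2 n ltac:(lia).
have -> : u n - (x, y) = RtoC (Re (u n) - x) + ci * RtoC (Im (u n) - y).
  case: (u n) => a b; rewrite /ci /RtoC /Cminus /Cplus /Cmult /Copp /Re /Im /=.
  by congr (_, _); ring.
have := Cmod_triangle (RtoC (Re (u n) - x)) (ci * RtoC (Im (u n) - y)).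
rewrite Cmod_mult !Cmod_R.
have -> : Cmod ci = 1%R.
  by rewrite /ci /Cmod /= (_ : (_ + _ = 1)%R) ?sqrt_1 //; ring.
lra.
Qed.

Lemma qpoch_fin_add (a q : C) (m n : nat) :
  qpoch_fin a q (m + n)%coq_nat = qpoch_fin a q m * qpoch_fin (a * Cpow q m) q n.
Proof.
elim: n => [|n IH]; first by rewrite Nat.add_0_r /= Cmult_1_r.
by rewrite Nat.add_succ_r /= IH Cpow_add_r; ring.
Qed.

Lemma qpoch_fin_neq0 (a q : C) (n : nat) :
  (forall k, 1 - a * Cpow q k <> 0) -> qpoch_fin a q n <> 0.
Proof.
move=> H; elim: n => [|n IH] /=; first by move/RtoC_inj; lra.
exact: Cmult_neq_0.
Qed.

Section QPochConvergence.
Variable q : C.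
Hypothesis q1 : (Cmod q < 1)%R.

(** The bound |prod (1 - x_k) - 1| <= exp(sum |x_k|) - 1, where the geometric sum of |a q^k| is at
    most |a| / (1 - |q|). It is uniform in [n], which gives boundedness, the Cauchy property and
    nonvanishing of the limit. *)
Lemma qpoch_fin_near1 (a : C) (n : nat) :
  (Cmod (qpoch_fin a q n - 1) <= exp (Cmod a / (1 - Cmod q)) - 1)%R.
Proof.
have a0 := Cmod_ge_0 a; have q0 := Cmod_ge_0 q.
pose S n := (Cmod a * ((1 - Cmod q ^ n) / (1 - Cmod q)))%R.
have SS k : (S k.+1 = S k + Cmod a * Cmod q ^ k)%R by rewrite /S /=; field; lra.
suff H : (Cmod (qpoch_fin a q n - 1) <= exp (S n) - 1)%R.
  suff : (exp (S n) <= exp (Cmod a / (1 - Cmod q)))%R by lra.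
  have : (S n <= Cmod a / (1 - Cmod q))%R.
    apply: Rmult_le_compat_l => //.
    rewrite -[X in (_ <= X)%R]Rmult_1_l; apply: Rmult_le_compat_r.
      by left; apply: Rinv_0_lt_compat; lra.
    have := pow_le _ n q0; lra.
  by case=> [/exp_increasing|->]; lra.
elim: n => [|n IH].
  have -> : S 0%N = 0%R by rewrite /S /=; field; lra.
  rewrite /= /Cminus Cplus_opp_r Cmod_0 exp_0; lra.
have x0 : (0 <= Cmod a * Cmod q ^ n)%R by apply: Rmult_le_pos => //; apply: pow_le.
set x := (Cmod a * Cmod q ^ n)%R in x0.
have xE : Cmod (a * Cpow q n) = x by rewrite Cmod_mult Cmod_pow.
rewrite SS exp_plus /= -/x.
have -> : qpoch_fin a q n * (1 - a * Cpow q n) - 1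
  = (qpoch_fin a q n - 1) + (- (qpoch_fin a q n - 1) * (a * Cpow q n) + - (a * Cpow q n)) by ring.
apply: (Rle_trans _ _ _ (Cmod_triangle _ _)).
have T := Cmod_triangle (- (qpoch_fin a q n - 1) * (a * Cpow q n)) (- (a * Cpow q n)).
rewrite Cmod_mult !Cmod_opp xE in T.
set d := Cmod (qpoch_fin a q n - 1) in IH T *.
have d0 : (0 <= d)%R := Cmod_ge_0 _.
have ex : (1 + x <= exp x)%R by apply: exp_ineq1_le.
have h1 : (d * x <= (exp (S n) - 1) * x)%R by apply: Rmult_le_compat_r.
have h2 : (exp (S n) * (1 + x) <= exp (S n) * exp x)%R.
  by apply: Rmult_le_compat_l => //; left; apply: exp_pos.
lra.
Qed.

Lemma qpoch_fin_bounded (a : C) : exists K, (0 < K)%R /\ forall n, (Cmod (qpoch_fin a q n) <= K)%R.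
Proof.
exists (exp (Cmod a / (1 - Cmod q)))%R; split=> [|n]; first exact: exp_pos.
have -> : qpoch_fin a q n = (qpoch_fin a q n - 1) + 1 by ring.
apply: (Rle_trans _ _ _ (Cmod_triangle _ _)); rewrite Cmod_1.
have := qpoch_fin_near1 a n; lra.
Qed.

Lemma qpoch_tail_near1 (a : C) (e : R) : (0 < e)%R ->
  exists N, forall n, (Cmod (qpoch_fin (a * Cpow q N) q n - 1) <= e)%R.
Proof.
move=> He; have a0 := Cmod_ge_0 a.
have lp : (0 < ln (1 + e))%R by rewrite -ln_1; apply: ln_increasing; lra.
have [N HN] := pow_lt_1_zero (Cmod q) ltac:(by rewrite Rabs_pos_eq //; apply: Cmod_ge_0)
  (ln (1 + e) * (1 - Cmod q) / (Cmod a + 1))%R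
  ltac:(by apply: Rdiv_lt_0_compat; [apply: Rmult_lt_0_compat|]; lra).
exists N => n; apply: (Rle_trans _ _ _ (qpoch_fin_near1 _ _)).
have {}HN := HN N (Nat.le_refl N).
have qN : (0 <= Cmod q ^ N)%R by apply: pow_le; apply: Cmod_ge_0.
rewrite (Rabs_pos_eq _ qN) in HN.
rewrite Cmod_mult Cmod_pow.
suff : (exp (Cmod a * Cmod q ^ N / (1 - Cmod q)) < exp (ln (1 + e)))%R by rewrite exp_ln; lra.
apply: exp_increasing.
apply: (Rmult_lt_reg_r (1 - Cmod q)); first lra.
have -> : (Cmod a * Cmod q ^ N / (1 - Cmod q) * (1 - Cmod q) = Cmod a * Cmod q ^ N)%R by field; lra.
apply: (Rle_lt_trans _ ((Cmod a + 1) * Cmod q ^ N)%R); first by apply: Rmult_le_compat_r; lra.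
apply: (Rlt_le_trans _ ((Cmod a + 1) * (ln (1 + e) * (1 - Cmod q) / (Cmod a + 1)))%R).
  by apply: Rmult_lt_compat_l; lra.
by right; field; lra.
Qed.

(** Here the limit chosen by [epsilon] becomes a genuine one: existence follows from the Cauchy
    criterion, because a bounded initial product is multiplied by a tail close to 1. *)
Lemma qpoch_inf_cv (a : C) : Ccv (qpoch_fin a q) (qpoch_inf a q).
Proof.
apply/Ccv_filterlim.
apply: (epsilon_spec (inhabits (RtoC 0))
  (fun L => filterlim (qpoch_fin a q) eventually (locally L))).
suff [L HL] : exists L, Ccv (qpoch_fin a q) L by exists L; apply/Ccv_filterlim.
apply: Ccv_cauchy => e He.
have [K [K0 HK]] := qpoch_fin_bounded a.
have [N HN] := qpoch_tail_near1 a (e := e / (2 * K)) ltac:(by apply: Rdiv_lt_0_compat; lra).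
exists N => n; rewrite qpoch_fin_add.
have -> : qpoch_fin a q N * qpoch_fin (a * Cpow q N) q n - qpoch_fin a q N =
   qpoch_fin a q N * (qpoch_fin (a * Cpow q N) q n - 1) by ring.
rewrite Cmod_mult.
apply: (Rle_lt_trans _ (K * (e / (2 * K)))%R).
  apply: Rmult_le_compat; [exact: Cmod_ge_0|exact: Cmod_ge_0|exact: HK|exact: HN].
have -> : (K * (e / (2 * K)) = e / 2)%R by field; lra.
lra.
Qed.

Lemma qpoch_inf_eq (a L : C) : Ccv (qpoch_fin a q) L -> qpoch_inf a q = L.
Proof. exact: Ccv_unique (qpoch_inf_cv a). Qed.

Lemma qpoch_inf_neq0 (a : C) : (forall k, 1 - a * Cpow q k <> 0) -> qpoch_inf a q <> 0.
Proof.
move=> H.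
(* A tail that stays within 1/2 of 1 cannot tend to 0, and the initial product has no zero
   factor. *)
have [N HN] := qpoch_tail_near1 a (e := (1 / 2)%R) ltac:(lra).
have -> : qpoch_inf a q = qpoch_fin a q N * qpoch_inf (a * Cpow q N) q.
  apply: Ccv_unique (Ccv_mult (Ccv_const _) (qpoch_inf_cv _)).
  apply: Ccv_ext (fun n => qpoch_fin_add a q N n) _.
  apply: (Ccv_subseq (s := fun n => (N + n)%coq_nat)) (qpoch_inf_cv a) => M.
  by exists M => n Hn; lia.
apply: Cmult_neq_0; first exact: qpoch_fin_neq0.
move=> h0; have [M HM] := qpoch_inf_cv (a * Cpow q N) (e := (1 / 2)%R) ltac:(lra).
have {}HM := HM M (Nat.le_refl _); have {}HN := HN M; rewrite h0 in HM.
have := Cmod_sub_trans 1 (qpoch_fin (a * Cpow q N) q M) 0.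
have -> : 1 - 0 = 1 by ring.
rewrite (Cmod_subC 1) Cmod_1; lra.
Qed.

Lemma qpoch_inf_neq0_small (a : C) : (Cmod a < 1)%R -> qpoch_inf a q <> 0.
Proof.
move=> a1; apply: qpoch_inf_neq0 => k h.
have : (Cmod (a * Cpow q k) < 1)%R.
  rewrite Cmod_mult Cmod_pow.
  have q0 := Cmod_ge_0 q; have a0 := Cmod_ge_0 a.
  have : (Cmod q ^ k <= 1)%R by rewrite -(pow1 k); apply: pow_incr; lra.
  have := pow_le _ k q0; nra.
have -> : a * Cpow q k = 1 by have -> : a * Cpow q k = 1 - (1 - a * Cpow q k) by [ring]; rewrite h; ring.
rewrite Cmod_1; lra.
Qed.

End QPochConvergence.

Lemma Cmod_pow_lt1 (q : C) (m : nat) : (Cmod q < 1)%R -> (0 < m)%coq_nat -> (Cmod (Cpow q m) < 1)%R.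
Proof.
move=> q1; have q0 := Cmod_ge_0 q; case: m => [|m] Hm; first lia.
rewrite Cmod_pow /=.
have : (Cmod q ^ m <= 1)%R by rewrite -(pow1 m); apply: pow_incr; lra.
have := pow_le _ m q0; nra.
Qed.

(** Sorts the factors 1 - a q^k by the residue of k modulo [m]; at finite level, [n] blocks of [m]
    consecutive factors. *)
Lemma qpoch_dissect (a q : C) (m : nat) : (Cmod q < 1)%R -> (0 < m)%coq_nat ->
  qpoch_inf a q = \big[Cmult/RtoC 1]_(j < m) qpoch_inf (a * Cpow q j) (Cpow q m).
Proof.
move=> q1 m0; have qm := Cmod_pow_lt1 q1 m0.
have fin n : qpoch_fin a q (m * n)%coq_nat =
   \big[Cmult/RtoC 1]_(j < m) qpoch_fin (a * Cpow q j) (Cpow q m) n.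
  elim: n => [|n IH]; first by rewrite Nat.mul_0_r big1.
  rewrite Nat.mul_succ_r qpoch_fin_add IH big_split /=; congr (_ * _).
  have E (b : C) k : qpoch_fin b q k = \big[Cmult/RtoC 1]_(j < k) (1 - b * Cpow q j).
    by elim: k => [|k IHk]; rewrite ?big_ord0 // big_ord_recr /= IHk.
  rewrite E; apply: eq_bigr => j _; rewrite Cpow_mult_r; ring.
apply: (Ccv_unique (u := fun n => qpoch_fin a q (m * n)%coq_nat)).
  apply: (Ccv_subseq (s := fun n => (m * n)%coq_nat)) (qpoch_inf_cv q1 a) => M.
  by exists M => n Hn; nia.
apply: Ccv_ext (fun n => esym (fin n)) _.
(* The number of factors is decoupled from the base [q ^ m], now an arbitrary [p] in the unit disc;
   otherwise induction on [m] would change the base as well. *)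
elim: (m) (Cpow q m) qm => [|k IH] p Hp.
  by rewrite big_ord0; apply: (Ccv_ext (u := fun=> RtoC 1)) (Ccv_const _) => n; rewrite big_ord0.
rewrite big_ord_recr /=; apply: Ccv_ext (Ccv_mult (IH p Hp) (qpoch_inf_cv Hp (a * Cpow q k))) => n.
by rewrite big_ord_recr.
Qed.

Lemma qpoch_mul_opp (a q : C) : (Cmod q < 1)%R ->
  qpoch_inf a q * qpoch_inf (- a) q = qpoch_inf (a * a) (q * q).
Proof.
move=> q1.
have q2 : (Cmod (q * q) < 1)%R.
  by rewrite Cmod_mult; have := Cmod_ge_0 q; nra.
apply: esym; apply: qpoch_inf_eq => //.
apply: Ccv_ext (Ccv_mult (qpoch_inf_cv q1 a) (qpoch_inf_cv q1 (- a))).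
elim=> [|n IH] /=; first by ring.
by rewrite -IH Cpow_mult_l; ring.
Qed.

(* The product over the five conjugates [z^j x]: the factor [1 - x^k] contributes
   [1 - x^(5k)] when 5 does not divide [k], and [(1 - x^k)^5] otherwise. *)
Lemma qpoch_conjugates (z x : C) : 1 + z + z ^ 2 + z ^ 3 + z ^ 4 = 0 -> (Cmod x < 1)%R ->
  let f j := qpoch_inf (z ^ j * x) (z ^ j * x) in
  f 0%N * f 1%N * f 2%N * f 3%N * f 4%N * qpoch_inf (x ^ 25) (x ^ 25) = (qpoch_inf (x ^ 5) (x ^ 5)) ^ 6.
Proof.
move=> Hz x1 f.
have z5 : z ^ 5 = 1.
  have -> : z ^ 5 = 1 + (z - 1) * (1 + z + z ^ 2 + z ^ 3 + z ^ 4) by ring.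
  rewrite Hz; ring.
have z4 : z ^ 4 = - (1 + z + z ^ 2 + z ^ 3).
  have -> : z ^ 4 = - (1 + z + z ^ 2 + z ^ 3) + (1 + z + z ^ 2 + z ^ 3 + z ^ 4) by ring.
  rewrite Hz; ring.
(* For i = 1, ..., 4 the powers z^(ij) again run through all fifth roots of unity, whence the
   product 1 - y^5. *)
have c1 (y : C) : (1 - (z ^ 0) ^ 1 * y) * (1 - (z ^ 1) ^ 1 * y) * (1 - (z ^ 2) ^ 1 * y) *
    (1 - (z ^ 3) ^ 1 * y) * (1 - (z ^ 4) ^ 1 * y) = 1 - y ^ 5 by ring [z5 z4].
have c2 (y : C) : (1 - (z ^ 0) ^ 2 * y) * (1 - (z ^ 1) ^ 2 * y) * (1 - (z ^ 2) ^ 2 * y) *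
    (1 - (z ^ 3) ^ 2 * y) * (1 - (z ^ 4) ^ 2 * y) = 1 - y ^ 5 by ring [z5 z4].
have c3 (y : C) : (1 - (z ^ 0) ^ 3 * y) * (1 - (z ^ 1) ^ 3 * y) * (1 - (z ^ 2) ^ 3 * y) *
    (1 - (z ^ 3) ^ 3 * y) * (1 - (z ^ 4) ^ 3 * y) = 1 - y ^ 5 by ring [z5 z4].
have c4 (y : C) : (1 - (z ^ 0) ^ 4 * y) * (1 - (z ^ 1) ^ 4 * y) * (1 - (z ^ 2) ^ 4 * y) *
    (1 - (z ^ 3) ^ 4 * y) * (1 - (z ^ 4) ^ 4 * y) = 1 - y ^ 5 by ring [z5 z4].
(* Since |z| = 1, all five conjugates of [x] lie in the unit disc and their products converge. *)
have zm : Cmod z = 1%R.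
  have h : (Cmod z ^ 5 = 1)%R by rewrite -Cmod_pow z5 Cmod_1.
  have z0 := Cmod_ge_0 z.
  apply: Rle_antisym; apply: Rnot_lt_le => hl.
    have : (1 < Cmod z ^ 5)%R by apply: Rlt_pow_R1 => //; lia.
    lra.
  have h4 : (Cmod z ^ 4 <= 1)%R by rewrite -(pow1 4); apply: pow_incr; lra.
  have h5 : (Cmod z ^ 5 = Cmod z * Cmod z ^ 4)%R by [].
  have := Rmult_le_compat_l _ _ _ z0 h4; lra.
have lt1 (j : nat) : (Cmod (Cpow z j * x) < 1)%R.
  by rewrite Cmod_mult Cmod_pow zm pow1 Rmult_1_l.
have x5 := Cmod_pow_lt1 (m := 5) x1 ltac:(lia).
have x25 := Cmod_pow_lt1 (m := 25) x1 ltac:(lia).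
pose F (j : nat) n := qpoch_fin (Cpow z j * x) (Cpow z j * x) (5 * n)%coq_nat.
pose G n := qpoch_fin (x ^ 25) (x ^ 25) n.
pose H n := qpoch_fin (x ^ 5) (x ^ 5) n.
(* [H (5 * n)] ranges over 1 - x^(5k) for all k <= 5n, including the multiples of 5; those extra
   factors are supplied on the left by [G n]. The fifth powers coming from k divisible by 5 form
   [H n ^ 5]. *)
have fin n : F 0%N n * F 1%N n * F 2%N n * F 3%N n * F 4%N n * G n =
    H (5 * n)%coq_nat * (H n) ^ 5.
  elim: n => [|n IH]; first by rewrite /F /G /H /=; ring.
  pose X := (x ^ 5) ^ n.
  pose P (i j : nat) := 1 - (z ^ j) ^ i * (X * x ^ i).
  have FS (j : nat) : F j n.+1 =
      F j n * (P 1%N j * P 2%N j * P 3%N j * P 4%N j * (1 - X * x ^ 5)).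
    rewrite /F Nat.mul_succ_r qpoch_fin_add Cpow_mult_r /=; congr (_ * _).
    have zj : (z ^ j) ^ 5 = 1 by rewrite -Cpow_mult_r Nat.mul_comm Cpow_mult_r z5 Cpow_1_l.
    have -> : (z ^ j * x) * ((z ^ j * x) * ((z ^ j * x) * ((z ^ j * x) * (z ^ j * x * 1))))
      = x ^ 5 by transitivity ((z ^ j) ^ 5 * x ^ 5); [ring|rewrite zj; ring].
    rewrite -/X /P; move: (z ^ j) zj => w zj; ring [zj].
  have conj1 : P 1%N 0%N * P 1%N 1%N * P 1%N 2%N * P 1%N 3%N * P 1%N 4%N = 1 - (X * x ^ 1) ^ 5.
    exact: c1.
  have conj2 : P 2%N 0%N * P 2%N 1%N * P 2%N 2%N * P 2%N 3%N * P 2%N 4%N = 1 - (X * x ^ 2) ^ 5.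
    exact: c2.
  have conj3 : P 3%N 0%N * P 3%N 1%N * P 3%N 2%N * P 3%N 3%N * P 3%N 4%N = 1 - (X * x ^ 3) ^ 5.
    exact: c3.
  have conj4 : P 4%N 0%N * P 4%N 1%N * P 4%N 2%N * P 4%N 3%N * P 4%N 4%N = 1 - (X * x ^ 4) ^ 5.
    exact: c4.
  have HS : H (5 * n.+1)%coq_nat = H (5 * n)%coq_nat *
      ((1 - (X * x ^ 1) ^ 5) * (1 - (X * x ^ 2) ^ 5) *
       (1 - (X * x ^ 3) ^ 5) * (1 - (X * x ^ 4) ^ 5) * (1 - (X * x ^ 5) ^ 5)).
    rewrite /H Nat.mul_succ_r qpoch_fin_add; congr (_ * _).
    have -> : (x ^ 5) ^ (5 * n)%coq_nat = X ^ 5 by rewrite Nat.mul_comm Cpow_mult_r.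
    rewrite /qpoch_fin; ring.
  have GS : G n.+1 = G n * (1 - (X * x ^ 5) ^ 5).
    rewrite /G /= -/X; congr (_ * (1 - _)).
    have -> : (x * (x * (x * (x * (x * (x * (x * (x * (x * (x * (x * (x * (x * (x * (x * (x * (x * (x * (x * (x * (x * (x * (x * (x * (x * 1))))))))))))))))))))))))) ^ n = X ^ 5.
      by rewrite -[X in X ^ n = _]/(x ^ 25) /X -!Cpow_mult_r; congr Cpow; lia.
    ring.
  have HS1 : H n.+1 = H n * (1 - X * x ^ 5) by rewrite /H /= -/X; ring.
  rewrite !FS HS GS HS1 -conj1 -conj2 -conj3 -conj4.
  have {}IH : F 0%N n * F 1%N n * F 2%N n * F 3%N n * F 4%N n * G n *
    (1 - X * x ^ 5) ^ 5 * (1 - (X * x ^ 5) ^ 5) = H (5 * n)%coq_nat * (H n) ^ 5 *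
    (1 - X * x ^ 5) ^ 5 * (1 - (X * x ^ 5) ^ 5) by rewrite IH.
  move: (F 0%N n) (F 1%N n) (F 2%N n) (F 3%N n) (F 4%N n) IH => f0 f1 f2 f3 f4 IH.
  transitivity (f0 * f1 * f2 * f3 * f4 * G n * (1 - X * x ^ 5) ^ 5 * (1 - (X * x ^ 5) ^ 5) *
    ((P 1%N 0%N * P 1%N 1%N * P 1%N 2%N * P 1%N 3%N * P 1%N 4%N) *
     (P 2%N 0%N * P 2%N 1%N * P 2%N 2%N * P 2%N 3%N * P 2%N 4%N) *
     (P 3%N 0%N * P 3%N 1%N * P 3%N 2%N * P 3%N 3%N * P 3%N 4%N) *
     (P 4%N 0%N * P 4%N 1%N * P 4%N 2%N * P 4%N 3%N * P 4%N 4%N))).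
    by move: (1 - X * x ^ 5) (1 - (X * x ^ 5) ^ 5) => u v; ring.
  rewrite IH; move: (1 - X * x ^ 5) (1 - (X * x ^ 5) ^ 5) => u v; ring.
have cvF (j : nat) : Ccv (F j) (f j).
  apply: (Ccv_subseq (s := fun n => (5 * n)%coq_nat)) (qpoch_inf_cv (lt1 j) _) => M.
  by exists M => n Hn; lia.
have cvH : Ccv H (qpoch_inf (x ^ 5) (x ^ 5)) := qpoch_inf_cv x5 _.
have cvH5 : Ccv (fun n => H (5 * n)%coq_nat) (qpoch_inf (x ^ 5) (x ^ 5)).
  apply: (Ccv_subseq (s := fun n => (5 * n)%coq_nat)) cvH => M.
  by exists M => n Hn; lia.
apply: Ccv_unique (Ccv_mult (Ccv_mult (Ccv_mult (Ccv_mult (Ccv_mult (cvF 0%N) (cvF 1%N)) (cvF 2%N))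
    (cvF 3%N)) (cvF 4%N)) (qpoch_inf_cv x25 (x ^ 25))) _.
apply: Ccv_ext (fun n => esym (fin n)) _.
apply: Ccv_mult cvH5 (Ccv_mult cvH (Ccv_mult cvH (Ccv_mult cvH (Ccv_mult cvH
  (Ccv_mult cvH (Ccv_const 1)))))).
Qed.

(** * The Jacobi triple product *)

HB.instance Definition _ := hasDecEq.Build Z Z.eqb_spec.

Definition ZtoC (n : Z) : C := RtoC (IZR n).

Lemma ZtoC_add (m n : Z) : ZtoC (m + n) = ZtoC m + ZtoC n.
Proof. by rewrite /ZtoC plus_IZR RtoC_plus. Qed.

Lemma ZtoC_sub (m n : Z) : ZtoC (m - n) = ZtoC m - ZtoC n.
Proof. by rewrite /ZtoC minus_IZR RtoC_minus. Qed.

Lemma ZtoC_mul (m n : Z) : ZtoC (m * n) = ZtoC m * ZtoC n.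
Proof. by rewrite /ZtoC mult_IZR RtoC_mult. Qed.

Definition ZtoCE := (ZtoC_add, ZtoC_sub, ZtoC_mul).

(** The general term of a theta series, with logarithms [a] and [b] in place of the nome and the
    variable: half-integral exponents are then unambiguous. *)
Definition gauss (a b : C) (n : Z) : C := cexp (a * (ZtoC n * ZtoC n) + b * ZtoC n).

Lemma abs_summable_le (I : eqType) (f h : I -> C) (K : R) : (0 <= K)%R ->
  (forall i, (Cmod (f i) <= K * Cmod (h i))%R) -> abs_summable h -> abs_summable f.
Proof.
move=> K0 H [M HM]; exists (K * M)%R => s us.
apply: (Rle_trans _ (Rsum s (fun i => K * Cmod (h i))%R)); first by apply: Rsum_le.
have -> : Rsum s (fun i => K * Cmod (h i))%R = (K * Rsum s (fun i => Cmod (h i)))%R.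
  elim: (s) => [|x t IH]; rewrite ?big_nil ?big_cons ?IH; ring.
by apply: Rmult_le_compat_l => //; apply: HM.
Qed.

Lemma Rsum_half_pow (t : seq nat) : uniq t -> (Rsum t (fun k => (1 / 2) ^ k) <= 2)%R.
Proof.
move=> ut; pose N := (\max_(i <- t) i).+1.
have hp k : (0 <= (1 / 2) ^ k)%R by apply: pow_le; lra.
apply: (Rle_trans _ (Rsum (seq.iota 0%nat N) (fun k => (1 / 2) ^ k)%R)).
  apply: Rsum_subset => //; first exact: iota_uniq.
  by move=> i Hi; rewrite mem_iota add0n ltnS; apply: (leq_bigmax_seq i).
suff -> : Rsum (seq.iota 0%nat N) (fun k => (1 / 2) ^ k)%R = (2 - 2 * (1 / 2) ^ N)%R by have := hp N; lra.
elim: (N) => [|n IH]; first by rewrite big_nil /=; ring.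
rewrite -addn1 iotaD big_cat IH add0n big_cons big_nil addn1 /=; field.
Qed.

Lemma abs_summable_half_pow : abs_summable (fun n : Z => RtoC ((1 / 2) ^ Z.abs_nat n)).
Proof.
exists 4%R => s us.
have hp k : (0 <= (1 / 2) ^ k)%R by apply: pow_le; lra.
have -> : Rsum s (fun i => Cmod (RtoC ((1 / 2) ^ Z.abs_nat i))) =
    Rsum s (fun i => (1 / 2) ^ Z.abs_nat i)%R.
  by apply: eq_bigr => i _; rewrite Cmod_R Rabs_pos_eq.
have half (p : pred Z) : {in p &, injective Z.abs_nat} ->
    (Rsum [seq i <- s | p i] (fun i => (1 / 2) ^ Z.abs_nat i) <= 2)%R.
  move=> inj; rewrite -(big_map Z.abs_nat xpredT (fun k => (1 / 2) ^ k)%R).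
  apply: Rsum_half_pow; rewrite map_inj_in_uniq ?filter_uniq // => x y.
  by rewrite !mem_filter => /andP[px _] /andP[py _]; apply: inj.
have h1 : (Rsum [seq i <- s | (0 <=? i)%Z] (fun i => (1 / 2) ^ Z.abs_nat i) <= 2)%R.
  by apply: half => x y /Z.leb_le hx /Z.leb_le hy; lia.
have h2 : (Rsum [seq i <- s | predC (fun i => (0 <=? i)%Z) i] (fun i => (1 / 2) ^ Z.abs_nat i) <= 2)%R.
  by apply: half => x y; rewrite !inE /= -!Z.ltb_antisym => /Z.ltb_lt hx /Z.ltb_lt hy; lia.
rewrite -(perm_big _ (permEl (perm_filterC (fun i => (0 <=? i)%Z) s))) big_cat /=.
apply: (Rle_trans _ (2 + 2)%R); [exact: Rplus_le_compat h1 h2|lra].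
Qed.

(** Completing the square bounds the real part of the exponent by a constant minus |n|, because its
    quadratic coefficient is negative; then exp(-|n|) <= 2^(-|n|). *)
Lemma abs_summable_gauss (a b : C) : (Re a < 0)%R -> abs_summable (gauss a b).
Proof.
move=> a0; set al := Re a in a0; set g := (Rabs (Re b) + 1)%R.
apply: abs_summable_le (exp (g * g / (4 * - al))) _ _ abs_summable_half_pow.
  by left; apply: exp_pos.
move=> n; rewrite Cmod_R Rabs_pos_eq; last by apply: pow_le; lra.
rewrite /gauss Cmod_cexp.
pose x := IZR n.
have -> : Re (a * (ZtoC n * ZtoC n) + b * ZtoC n) = (al * (x * x) + Re b * x)%R.
  by rewrite /ZtoC /Re /= -/x /al /Re; ring.
have half k : (exp (- INR k) <= (1 / 2) ^ k)%R.
  elim: k => [|k IH]; first by rewrite /= Ropp_0 exp_0; right.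
  rewrite S_INR Ropp_plus_distr exp_plus /= Rmult_comm.
  apply: Rmult_le_compat => //; try by left; apply: exp_pos.
  rewrite exp_Ropp /Rdiv Rmult_1_l; apply: Rinv_le_contravar; first lra.
  have := exp_ineq1_le 1; lra.
apply: (Rle_trans _ (exp (g * g / (4 * - al)) * exp (- INR (Z.abs_nat n)))%R); last first.
  by apply: Rmult_le_compat_l; [left; apply: exp_pos|apply: half].
rewrite -exp_plus INR_IZR_INZ Zabs2Nat.id_abs abs_IZR -/x.
have : (al * (x * x) + Re b * x <= g * g / (4 * - al) + - Rabs x)%R.
  have h1 : (Re b * x <= Rabs (Re b) * Rabs x)%R by rewrite -Rabs_mult; apply: Rle_abs.
  have -> : (x * x = Rabs x * Rabs x)%R by rewrite -Rabs_mult Rabs_pos_eq //; nra.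
  set t := Rabs x in h1 *.
  have h2 : (0 <= - al * ((t - g / (2 * - al)) * (t - g / (2 * - al))))%R.
    by apply: Rmult_le_pos; [lra|apply: Rle_0_sqr].
  have h3 : (- al * ((t - g / (2 * - al)) * (t - g / (2 * - al)))
     = - al * (t * t) - g * t + g * g / (4 * - al))%R by field; lra.
  have h4 : (g * t = Rabs (Re b) * t + t)%R by rewrite /g; ring.
  lra.
by case=> [/exp_increasing|->]; lra.
Qed.

Lemma Ccv_bounded (u : nat -> C) (L : C) : Ccv u L -> exists K, (0 <= K)%R /\ forall n, (Cmod (u n) <= K)%R.
Proof.
move=> /(_ 1%R ltac:(lra)) [N HN].
have [K [K0 HK]] : exists K, (0 <= K)%R /\ forall n, (n < N)%coq_nat -> (Cmod (u n) <= K)%R.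
  elim: (N) => [|m [K [K0 HK]]]; first by exists 0%R; split=> [|n]; [right|lia].
  exists (K + Cmod (u m))%R; split; first by have := Cmod_ge_0 (u m); lra.
  move=> n Hn; have [->|hn] : n = m \/ (n < m)%coq_nat by lia.
    lra.
  by have := HK n hn; have := Cmod_ge_0 (u m); lra.
exists (K + Cmod L + 1)%R; split; first by have := Cmod_ge_0 L; lra.
move=> n; have [h|h] : (n < N)%coq_nat \/ (N <= n)%coq_nat by lia.
  by have := HK n h; have := Cmod_ge_0 L; lra.
have := HN n h; have := Cmod_triangle (u n - L) L.
have -> : u n - L + L = u n by ring.
lra.
Qed.

(* The right-hand side of the Jacobi triple product for [\sum_n cexp (a n^2 + b n)]. *)
Definition theta (a b : C) : C :=
  qpoch_inf (cexp (2 * a)) (cexp (2 * a)) *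
  (qpoch_inf (- cexp (a + b)) (cexp (2 * a)) * qpoch_inf (- cexp (a - b)) (cexp (2 * a))).

Lemma Cmod_cexp_lt1 (a : C) : (Re a < 0)%R -> (Cmod (cexp a) < 1)%R.
Proof. by move=> h; rewrite Cmod_cexp -exp_0; apply: exp_increasing. Qed.

Lemma Re_scal_neg (r : R) (a : C) : (0 < r)%R -> (Re a < 0)%R -> (Re (RtoC r * a) < 0)%R.
Proof. rewrite /Re /= => *; nra. Qed.

Section JacobiTripleProduct.
Variables a b : C.
Hypothesis a0 : (Re a < 0)%R.
Let q := cexp (2 * a).

Let q1 : (Cmod q < 1)%R.
Proof. by apply: Cmod_cexp_lt1; apply: Re_scal_neg; lra. Qed.

(* [1 / (q;q)_z], extended by 0 to negative [z]: then the recurrence [iq_pred] has no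
   boundary case, and [jfin] below is the finite triple product, whose coefficients are
   the Gaussian binomials [2n choose n+j]. *)
Let iq (z : Z) : C := if (z <? 0)%Z then RtoC 0 else / qpoch_fin q q (Z.to_nat z).

Let qpow_neq1 k : 1 - q * Cpow q k <> 0.
Proof.
move=> h; have : (Cmod (Cpow q k.+1) < 1)%R by apply: Cmod_pow_lt1 => //; lia.
have -> : Cpow q k.+1 = 1 by have -> : Cpow q k.+1 = 1 - (1 - q * Cpow q k) by [rewrite /=; ring]; rewrite h; ring.
rewrite Cmod_1; lra.
Qed.

Let iq_pred (z : Z) : iq (z - 1) = (1 - cexp (2 * a * ZtoC z)) * iq z.
Proof.
rewrite /iq; case: (Z.ltb_spec (z - 1) 0) => h1; case: (Z.ltb_spec z 0) => h2; try lia.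
- by rewrite Cmult_0_r.
- have -> : z = 0%Z by lia.
  by rewrite /ZtoC Cmult_0_r cexp_0; ring.
have -> : Z.to_nat z = (Z.to_nat (z - 1)).+1 by lia.
have -> : cexp (2 * a * ZtoC z) = q * Cpow q (Z.to_nat (z - 1)).
  rewrite -cexp_mult_nat INR_IZR_INZ Z2Nat.id; last lia.
  rewrite -cexp_add -/(ZtoC (z - 1)) ZtoC_sub /ZtoC; congr cexp; ring.
rewrite /=; field; split; first exact: qpow_neq1.
exact: qpoch_fin_neq0.
Qed.

Let jfin (n : nat) (j : Z) : C :=
  qpoch_fin q q (2 * n)%coq_nat * iq (Z.of_nat n + j) * iq (Z.of_nat n - j) * gauss a b j.

Let jprod n := qpoch_fin (- cexp (a + b)) q n * qpoch_fin (- cexp (a - b)) q n.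

Let gauss_pred (j : Z) : gauss a b (j - 1) = gauss a b j * cexp (a - b - 2 * a * ZtoC j).
Proof. by rewrite /gauss -cexp_add ZtoCE /ZtoC; congr cexp; ring. Qed.

Let gauss_succ (j : Z) : gauss a b (j + 1) = gauss a b j * cexp (a + b + 2 * a * ZtoC j).
Proof. by rewrite /gauss -cexp_add ZtoCE /ZtoC; congr cexp; ring. Qed.

(** The q-Pascal recurrence. Passing from [n] to [n + 1] multiplies [jprod n] by (1 + e^(a+b) q^n)(1
    + e^(a-b) q^n) = 1 + q^(2n+1) + e^(a+b) q^n + e^(a-b) q^n, whose last two terms move the index
    [j] by one. *)
Let jfin_step (n : nat) (j : Z) : jfin n.+1 j =
  (1 + q * Cpow q (2 * n)%coq_nat) * jfin n j +
  (cexp (a + b) * Cpow q n * jfin n (j - 1) + cexp (a - b) * Cpow q n * jfin n (j + 1)).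
Proof.
pose N := Z.of_nat n; rewrite /jfin -/N.
have -> : Z.of_nat n.+1 = (N + 1)%Z by lia.
have -> : (2 * n.+1)%coq_nat = (2 * n)%coq_nat.+2 by lia.
pose X := iq (N + 1 + j); pose Y := iq (N + 1 - j).
(* With u = q^(n+1+j) and v = q^(n+1-j) every coefficient is rational in u, v and q, since q^(2n) =
   u v / q^2; the recurrence is then a field identity. *)
pose u := cexp (2 * a * ZtoC (N + 1 + j)); pose v := cexp (2 * a * ZtoC (N + 1 - j)).
have e1 : iq (N + j) = (1 - u) * X by rewrite -iq_pred; congr iq; lia.
have e2 : iq (N - j) = (1 - v) * Y by rewrite -iq_pred; congr iq; lia.
have q0 : q <> 0 by exact: cexp_neq0.
have e3 : iq (N + (j - 1)) = (1 - u / q) * ((1 - u) * X).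
  rewrite -e1; have -> : (N + (j - 1) = N + j - 1)%Z by lia.
  rewrite iq_pred; congr ((1 - _) * _).
  by rewrite /u /q /Cdiv -cexp_opp -cexp_add !ZtoCE /ZtoC; congr cexp; ring.
have e4 : iq (N - (j + 1)) = (1 - v / q) * ((1 - v) * Y).
  rewrite -e2; have -> : (N - (j + 1) = N - j - 1)%Z by lia.
  rewrite iq_pred; congr ((1 - _) * _).
  by rewrite /v /q /Cdiv -cexp_opp -cexp_add !ZtoCE /ZtoC; congr cexp; ring.
have e5 : iq (N - (j - 1)) = Y by congr iq; lia.
have e6 : iq (N + (j + 1)) = X by congr iq; lia.
rewrite e1 e2 e3 e4 e5 e6 -/X -/Y gauss_pred gauss_succ.
have qn k : Cpow q k = cexp (2 * a * ZtoC (Z.of_nat k)).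
  by rewrite -cexp_mult_nat INR_IZR_INZ; congr cexp; rewrite /ZtoC; ring.
have e7 : cexp (a + b) * Cpow q n * cexp (a - b - 2 * a * ZtoC j) = v.
  by rewrite qn -/N -!cexp_add /v !ZtoCE /ZtoC; congr cexp; ring.
have e8 : cexp (a - b) * Cpow q n * cexp (a + b + 2 * a * ZtoC j) = u.
  by rewrite qn -/N -!cexp_add /u !ZtoCE /ZtoC; congr cexp; ring.
have e9 : Cpow q (2 * n)%coq_nat = u * v / (q * q).
  rewrite qn /Cdiv /u /v /q -!cexp_add -cexp_opp -cexp_add Nat2Z.inj_mul !ZtoCE /ZtoC; congr cexp.
  rewrite -/N; ring.
have -> : qpoch_fin q q (2 * n)%coq_nat.+2 = qpoch_fin q q (2 * n)%coq_nat *
    (1 - q * Cpow q (2 * n)%coq_nat) * (1 - q * (q * Cpow q (2 * n)%coq_nat)) by [].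
rewrite e9; set P := qpoch_fin _ _ _; set G := gauss a b j.
transitivity ((1 + q * (u * v / (q * q))) * (P * ((1 - u) * X) * ((1 - v) * Y) * G) +
  ((cexp (a + b) * Cpow q n * cexp (a - b - 2 * a * ZtoC j)) *
    (P * ((1 - u / q) * ((1 - u) * X)) * Y * G) +
   (cexp (a - b) * Cpow q n * cexp (a + b + 2 * a * ZtoC j)) *
    (P * X * ((1 - v / q) * ((1 - v) * Y)) * G))); last by ring.
rewrite e7 e8; field; exact: q0.
Qed.

(** A sum over Z is invariant under index shifts, so the recurrence for the terms sums to the
    recurrence for [jprod]. *)
Let jfin_sum n : hassum (jfin n) (jprod n).
Proof.
elim: n => [|n IH].
  have H0 j : j \notin [:: 0%Z] -> jfin 0 j = 0.
    rewrite inE => /eqP hj; rewrite /jfin /= /iq.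
    case: (Z.ltb_spec j 0) => h1; first by ring.
    by case: (Z.ltb_spec (- j) 0) => h2; [ring|lia].
  have := hassum_finite_support (f := jfin 0) (s0 := [:: 0%Z]) isT H0.
  rewrite big_cons big_nil /jfin /jprod /iq /gauss /ZtoC /=.
  have -> : a * (0 * 0) + b * 0 = 0 by ring.
  rewrite cexp_0.
  by have -> : 1 * / 1 * / 1 * 1 + 0 = 1 * 1 by field.
have sh (c : Z) : hassum (fun j => jfin n (j + c)%Z) (jprod n).
  apply: (hassum_reindex (phi := fun j => (j + c)%Z)) IH => [x y|j]; first by lia.
  by exists (j - c)%Z; lia.
have -> : jprod n.+1 = (1 + q * Cpow q (2 * n)%coq_nat) * jprod n +
   (cexp (a + b) * Cpow q n * jprod n + cexp (a - b) * Cpow q n * jprod n).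
  have -> : Cpow q (2 * n)%coq_nat = Cpow q n * Cpow q n.
    by rewrite -Cpow_add_r; congr Cpow; lia.
  have E : q = cexp (a + b) * cexp (a - b) by rewrite -cexp_add /q; congr cexp; ring.
  rewrite /jprod /=; set Q := Cpow q n; set A := qpoch_fin _ _ _; set B := qpoch_fin _ _ _.
  rewrite {}E; ring.
apply: hassum_ext (hassum_plus (hassum_scal _ IH) (hassum_plus
   (hassum_scal _ (sh (-1)%Z)) (hassum_scal _ (sh 1%Z)))) => j.
by rewrite jfin_step.
Qed.

Let iq_bounded : exists K, (0 <= K)%R /\ forall z, (Cmod (iq z) <= K)%R.
Proof.
have L0 := qpoch_inf_neq0 q1 qpow_neq1.
have [K [K0 HK]] := Ccv_bounded (Ccv_inv L0 (qpoch_inf_cv q1 q)).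
exists K; split=> // z; rewrite /iq; case: (Z.ltb_spec z 0) => h; last exact: HK.
by rewrite Cmod_0.
Qed.

(** As n grows, (q;q)_(2n) / ((q;q)_(n+j) (q;q)_(n-j)) tends to 1 / (q;q)_infinity and stays
    bounded, so the finite triple product passes to the limit by dominated convergence. Comparing
    with the limit of [jprod] identifies the sum. *)
Lemma theta_sum : hassum (gauss a b) (theta a b).
Proof.
have sg := abs_summable_gauss b a0.
have [S HS] := abs_summable_ex sg.
suff -> : theta a b = S by [].
have L0 := qpoch_inf_neq0 q1 qpow_neq1.
pose L := qpoch_inf q q; rewrite -/L in L0.
have cv1 : Ccv jprod (/ L * S).
  have [K [K0 HK]] := iq_bounded.
  have [M [M0 HM]] := qpoch_fin_bounded q1 q.
  apply: (hassum_dominated (u := jfin) (f := fun j => / L * gauss a b j)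
    (d := fun j => RtoC (M * K * K) * gauss a b j)).
  - apply: abs_summable_le (M * K * K)%R _ _ sg; first by apply: Rmult_le_pos => //; nra.
    move=> j; rewrite Cmod_mult Cmod_R Rabs_pos_eq; first by right.
    by apply: Rmult_le_pos => //; nra.
  - move=> n j; rewrite /jfin !Cmod_mult Cmod_R Rabs_pos_eq; last by apply: Rmult_le_pos => //; nra.
    apply: Rmult_le_compat_r; first exact: Cmod_ge_0.
    apply: Rmult_le_compat; try (by apply: Cmod_ge_0); try (by apply: HK).
      by apply: Rmult_le_pos; apply: Cmod_ge_0.
    by apply: Rmult_le_compat; try (by apply: Cmod_ge_0); [apply: HM|apply: HK].
  - move=> j.
    have Q0 := qpoch_inf_cv q1 q.
    have cq (c : Z) : Ccv (fun n => iq (Z.of_nat n + c)) (/ L).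
      (* Once n >= |c| the index is nonnegative and [iq] is a true reciprocal, not its default value
         0. *)
      apply: (Ccv_ext_ge (u := fun n => / qpoch_fin q q (Z.to_nat (Z.of_nat n + c)))
        (N := Z.abs_nat c)) => [n Hn|].
        by rewrite /iq; case: Z.ltb_spec => // h; lia.
      apply: Ccv_inv => //.
      apply: (Ccv_subseq (s := fun n => Z.to_nat (Z.of_nat n + c))) Q0 => M'.
      by exists (M' + Z.abs_nat c)%coq_nat => n Hn; lia.
    have c2 : Ccv (fun n => qpoch_fin q q (2 * n)%coq_nat) L.
      apply: (Ccv_subseq (s := fun n => (2 * n)%coq_nat)) Q0 => M'.
      by exists M' => n Hn; lia.
    have -> : / L * gauss a b j = L * / L * / L * gauss a b j by field.
    exact: (Ccv_mult (Ccv_mult (Ccv_mult c2 (cq j)) (cq (- j)%Z)) (Ccv_const _)).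
  - exact: jfin_sum.
  - exact: hassum_scal.
have cv2 : Ccv jprod (qpoch_inf (- cexp (a + b)) q * qpoch_inf (- cexp (a - b)) q).
  by apply: Ccv_mult; apply: qpoch_inf_cv.
rewrite /theta (Ccv_unique cv2 cv1) -/q -/L; field; exact: L0.
Qed.

End JacobiTripleProduct.

(** * Theta functions *)

Lemma cexp_eq_mod (z w : C) (n : Z) : z = w + ZtoC n * (2 * ipi) -> cexp z = cexp w.
Proof. by move=> ->; rewrite cexp_add cexp_2ipi_Z Cmult_1_r. Qed.

Lemma theta_even (a b : C) : theta a (- b) = theta a b.
Proof.
rewrite /theta; have -> : a - - b = a + b by ring.
have -> : a + - b = a - b by ring.
ring.
Qed.

Lemma theta_period (a b c : C) (n : Z) : b = c + ZtoC n * (2 * ipi) -> theta a b = theta a c.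
Proof.
move=> E; rewrite /theta (cexp_eq_mod (z := a + b) (w := a + c) (n := n)); last by rewrite E; ring.
rewrite (cexp_eq_mod (z := a - b) (w := a - c) (n := (- n)%Z)) //.
by rewrite E /ZtoC opp_IZR RtoC_opp; ring.
Qed.

Lemma theta_shift (a b : C) : (Re a < 0)%R -> theta a (b + 2 * a) = cexp (- (a + b)) * theta a b.
Proof.
move=> a0; apply: hassum_unique (theta_sum _ a0) _.
have inj : injective (fun n : Z => (n + 1)%Z) by move=> x y; lia.
have surj n : exists m, (m + 1)%Z = n by exists (n - 1)%Z; lia.
apply: hassum_ext (hassum_scal _ (hassum_reindex inj surj (theta_sum b a0))) => n.
by rewrite /gauss -cexp_add !ZtoCE /ZtoC; congr cexp; ring.
Qed.

Lemma hassum_gauss_prod (a b c d : C) : (Re a < 0)%R -> (Re c < 0)%R ->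
  hassum (fun x : Z * Z => gauss a b x.1 * gauss c d x.2) (theta a b * theta c d).
Proof.
move=> a0 c0; apply: hassum_prod; [exact: abs_summable_gauss|exact: abs_summable_gauss|
  exact: theta_sum|exact: theta_sum].
Qed.

(** Z^2 splits by the parity of the sum of coordinates. On each class the substitution (m + n + i, m
    - n) diagonalises x^2 + y^2 into 2m^2 + 2n^2 plus linear terms. *)
Lemma theta_mul (a b c : C) : (Re a < 0)%R ->
  theta a (b + c) * theta a (b - c) =
  theta (2 * a) (2 * b) * theta (2 * a) (2 * c) +
  cexp (a + b + c) * (theta (2 * a) (2 * a + 2 * b) * theta (2 * a) (2 * a + 2 * c)).
Proof.
move=> a0; have a2 : (Re (2 * a) < 0)%R by apply: Re_scal_neg; lra.
pose phi (x : 'I_2 * (Z * Z)) : Z * Z :=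
  ((x.2.1 + x.2.2 + Z.of_nat x.1)%Z, (x.2.1 - x.2.2)%Z).
pose h (i : 'I_2) := if nat_of_ord i is 0%nat
  then theta (2 * a) (2 * b) * theta (2 * a) (2 * c)
  else cexp (a + b + c) * (theta (2 * a) (2 * a + 2 * b) * theta (2 * a) (2 * a + 2 * c)).
rewrite (hassum_partition (phi := phi) (h := h) _ _ _ (hassum_gauss_prod (b + c) (b - c) a0 a0)).
- by rewrite !big_ord_recl big_ord0 Cplus_0_r.
- move=> [i [m n]] [i' [m' n']]; rewrite /phi /= => [[e1 e2]].
  have li := ltn_ord i; have li' := ltn_ord i'; move/ltP: li => li; move/ltP: li' => li'.
  have ei : nat_of_ord i = nat_of_ord i' by lia.
  congr (_, (_, _)); [exact: ord_inj|lia|lia].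
- move=> [m n]; pose r := Z.to_nat ((m + n) mod 2).
  have hr := Z.mod_pos_bound (m + n) 2 ltac:(lia).
  have lr : (r < 2)%nat by apply/ltP; rewrite /r; lia.
  exists (Ordinal lr, (((m + n) / 2)%Z, ((m - n) / 2)%Z)); rewrite /phi /= /r Z2Nat.id; last lia.
  by congr (_, _); Z.to_euclidean_division_equations; lia.
case=> [[|[|//]] Hi]; rewrite /h /=.
- apply: hassum_ext (hassum_gauss_prod (2 * b) (2 * c) a2 a2) => [[m n]] /=.
  by rewrite /gauss -!cexp_add !ZtoCE /ZtoC /=; congr cexp; ring.
apply: hassum_ext (hassum_scal _ (hassum_gauss_prod (2 * a + 2 * b) (2 * a + 2 * c) a2 a2)) => [[m n]] /=.
by rewrite /gauss -!cexp_add !ZtoCE /ZtoC /=; congr cexp; ring.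
Qed.

Lemma theta_zero (a : C) (n : Z) : (Re a < 0)%R -> theta a (a + ipi + ZtoC n * (2 * ipi)) = 0.
Proof.
move=> a0; rewrite (theta_period a (c := a + ipi) (n := n)) // /theta.
have -> : - cexp (a - (a + ipi)) = 1.
  have -> : a - (a + ipi) = - ipi by ring.
  by rewrite cexp_opp cexp_ipi; field.
have -> : qpoch_inf 1 (cexp (2 * a)) = 0; last by ring.
apply: qpoch_inf_eq; first by apply: Cmod_cexp_lt1; apply: Re_scal_neg; lra.
apply: (Ccv_ext_ge (u := fun=> RtoC 0) (N := 1)); last exact: Ccv_const.
move=> n1 Hn; have -> : n1 = (1 + Nat.sub n1 1)%coq_nat by lia.
by rewrite qpoch_fin_add /=; ring.
Qed.

(** The substitution x = k + i - 2m, y = k + m has index 3 and turns x^2 + 2y^2 into 3k^2 + 6m^2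
    plus linear terms, so the product of two theta functions is a sum of three such products. The
    class i = 2 contains a theta function at one of its zeros, and the other two classes share a
    factor. *)
Lemma quintuple_product (a z : C) : (Re a < 0)%R ->
  theta a (z - a + ipi) * theta (2 * a) (2 * z + ipi) =
  theta (6 * a) (2 * a + ipi) * (theta (3 * a) (3 * z - a) - cexp z * theta (3 * a) (3 * z + a)).
Proof.
move=> a0; have a2 : (Re (2 * a) < 0)%R by apply: Re_scal_neg; lra.
have a3 : (Re (3 * a) < 0)%R by apply: Re_scal_neg; lra.
have a6 : (Re (6 * a) < 0)%R by apply: Re_scal_neg; lra.
pose phi (x : 'I_3 * (Z * Z)) : Z * Z :=
  ((x.2.1 + Z.of_nat x.1 - 2 * x.2.2)%Z, (x.2.2 + x.2.1)%Z).
pose h (i : 'I_3) := match nat_of_ord i with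
  | 0%nat => theta (3 * a) (3 * z - a + 2 * ipi) * theta (6 * a) (2 * a - ipi)
  | 1%nat => cexp (z + ipi) * (theta (3 * a) (3 * z + a + 2 * ipi) * theta (6 * a) (- 2 * a - ipi))
  | _ => cexp (2 * a + 2 * z + 2 * ipi) * (theta (3 * a) (3 * z + 3 * a + 2 * ipi) * theta (6 * a) (- 6 * a - ipi))
  end.
rewrite (hassum_partition (phi := phi) (h := h) _ _ _ (hassum_gauss_prod (z - a + ipi) (2 * z + ipi) a0 a2)).
- rewrite !big_ord_recl big_ord0 Cplus_0_r /h /=.
  rewrite (theta_period (3 * a) (c := 3 * z - a) (n := 1%Z)) ?/ZtoC; last by ring.
  rewrite (theta_period (3 * a) (b := 3 * z + a + 2 * ipi) (c := 3 * z + a) (n := 1%Z)) ?/ZtoC; last by ring.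
  rewrite (theta_period (6 * a) (b := 2 * a - ipi) (c := 2 * a + ipi) (n := (-1)%Z)) ?/ZtoC; last by ring.
  have -> : - 2 * a - ipi = - (2 * a + ipi) by ring.
  (* This argument is, up to sign, the zero of [theta (6 * a)]: the third class disappears. *)
  have -> : - 6 * a - ipi = - (6 * a + ipi + ZtoC 0 * (2 * ipi)) by rewrite /ZtoC; ring.
  rewrite !theta_even theta_zero // cexp_add cexp_ipi; ring.
- move=> [i [m n]] [i' [m' n']] E.
  have e1 : (m + Z.of_nat i - 2 * n = m' + Z.of_nat i' - 2 * n')%Z := f_equal fst E.
  have e2 : (n + m = n' + m')%Z := f_equal snd E.
  have li := ltn_ord i; have li' := ltn_ord i'; move/ltP: li => li; move/ltP: li' => li'.
  have ei : nat_of_ord i = nat_of_ord i' by lia.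
  congr (_, (_, _)); [exact: ord_inj|lia|lia].
- move=> [n m]; pose N := (n + 2 * m)%Z; pose r := Z.to_nat (N mod 3).
  have hr := Z.mod_pos_bound N 3 ltac:(lia).
  have lr : (r < 3)%nat by apply/ltP; rewrite /r; lia.
  exists (Ordinal lr, ((N / 3)%Z, (m - N / 3)%Z)); rewrite /phi; cbn [fst snd nat_of_ord]; rewrite /r Z2Nat.id; last lia.
  by congr (_, _); Z.to_euclidean_division_equations; lia.
case=> [[|[|[|//]]] Hi]; rewrite {}/h; cbn [nat_of_ord].
- apply: hassum_ext (hassum_gauss_prod (3 * z - a + 2 * ipi) (2 * a - ipi) a3 a6) => -[k m].
  by rewrite /gauss /phi; cbn [fst snd nat_of_ord]; rewrite -!cexp_add !ZtoCE /ZtoC [Z.of_nat _]/=; congr cexp; ring.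
- apply: hassum_ext (hassum_scal _ (hassum_gauss_prod (3 * z + a + 2 * ipi) (- 2 * a - ipi) a3 a6)) => -[k m].
  by rewrite /gauss /phi; cbn [fst snd nat_of_ord]; rewrite -!cexp_add !ZtoCE /ZtoC [Z.of_nat _]/=; congr cexp; ring.
apply: hassum_ext (hassum_scal _ (hassum_gauss_prod (3 * z + 3 * a + 2 * ipi) (- 6 * a - ipi) a3 a6)) => -[k m].
by rewrite /gauss /phi; cbn [fst snd nat_of_ord]; rewrite -!cexp_add !ZtoCE /ZtoC [Z.of_nat _]/=; congr cexp; ring.
Qed.

Lemma theta_dissect5 (a b : C) : (Re a < 0)%R ->
  theta a b = theta (25 * a) (5 * b) +
    cexp (a + b) * theta (25 * a) (5 * b + 10 * a) +
    cexp (4 * a + 2 * b) * theta (25 * a) (5 * b + 20 * a) +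
    cexp (9 * a + 3 * b) * theta (25 * a) (5 * b + 30 * a) +
    cexp (16 * a + 4 * b) * theta (25 * a) (5 * b + 40 * a).
Proof.
move=> a0; have a25 : (Re (25 * a) < 0)%R by apply: Re_scal_neg; lra.
pose phi (x : 'I_5 * Z) : Z := (5 * x.2 + Z.of_nat x.1)%Z.
pose t (j : nat) := ZtoC (Z.of_nat j).
pose h (j : nat) := cexp (a * (t j * t j) + b * t j) * theta (25 * a) (5 * b + 10 * a * t j).
have -> : theta a b = \big[Cplus/RtoC 0]_(j < 5) h j.
  apply: (hassum_partition (phi := phi)) (theta_sum b a0).
  - move=> [i k] [i' k'] E.
    have e : (5 * k + Z.of_nat i = 5 * k' + Z.of_nat i')%Z := E.
    have li := ltn_ord i; have li' := ltn_ord i'; move/ltP: li => li; move/ltP: li' => li'.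
    have ei : nat_of_ord i = nat_of_ord i' by lia.
    congr (_, _); [exact: ord_inj|lia].
  - move=> n; pose r := Z.to_nat (n mod 5).
    have hr := Z.mod_pos_bound n 5 ltac:(lia).
    have lr : (r < 5)%nat by apply/ltP; rewrite /r; lia.
    exists (Ordinal lr, (n / 5)%Z); rewrite /phi; cbn [fst snd nat_of_ord]; rewrite /r Z2Nat.id;
      Z.to_euclidean_division_equations; lia.
  move=> j; apply: hassum_ext (hassum_scal _ (theta_sum _ a25)) => k.
  by rewrite /gauss /phi /t; cbn [fst snd]; rewrite -!cexp_add !ZtoCE /ZtoC; congr cexp; ring.
rewrite -(big_mkord xpredT h) unlock /= Cplus_0_r -!Cplus_assoc /h /t /ZtoC.
congr (_ + (_ + (_ + (_ + _)))); try by congr (cexp _ * theta _ _); rewrite [Z.of_nat _]/=; ring.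
have -> : a * (IZR (Z.of_nat 0) * IZR (Z.of_nat 0)) + b * IZR (Z.of_nat 0) = 0.
  by rewrite [Z.of_nat _]/=; ring.
by rewrite cexp_0 Cmult_1_l; congr theta; rewrite [Z.of_nat _]/=; ring.
Qed.

(* [theta a] shifted by half a period: an odd function, vanishing at 0. *)
Definition otheta (a b : C) : C := cexp (b / 2) * theta a (b + a + ipi).

(* The products [otheta (b+c) * otheta (b-c)] are 2x2 minors of a matrix with two rows,
   so this is a Pluecker relation. *)
Lemma weierstrass_three_term (a b c d e : C) : (Re a < 0)%R ->
  let S := otheta a in
  S (b + c) * S (b - c) * (S (d + e) * S (d - e)) -
  S (b + d) * S (b - d) * (S (c + e) * S (c - e)) +
  S (b + e) * S (b - e) * (S (c + d) * S (c - d)) = 0.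
Proof.
move=> a0 S; have a2 : (Re (2 * a) < 0)%R by apply: Re_scal_neg; lra.
pose al x := theta (2 * a) (2 * x).
pose be x := cexp (a / 2 + x) * theta (2 * a) (2 * a + 2 * x).
(* The shift by [a + ipi] built into [otheta] exchanges the two theta functions of [x] in
   [theta_mul], up to an exponential and the sign of e^(i pi); this makes the two-term formula
   antisymmetric in [x] and [y]. *)
have D x y : S (x + y) * S (x - y) = cexp (- (a / 2)) * (be x * al y - al x * be y).
  rewrite /S /otheta.
  have -> : x + y + a + ipi = (x + a + ipi) + y by ring.
  have -> : x - y + a + ipi = (x + a + ipi) - y by ring.
  transitivity (cexp ((x + y) / 2) * cexp ((x - y) / 2) *
    (theta a (x + a + ipi + y) * theta a (x + a + ipi - y))); first by ring.
  rewrite theta_mul // -cexp_add.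
  have -> : (x + y) / 2 + (x - y) / 2 = x by field.
  rewrite (theta_period (2 * a) (b := 2 * (x + a + ipi)) (c := 2 * a + 2 * x) (n := 1%Z)); last by rewrite /ZtoC; ring.
  rewrite (theta_period (2 * a) (b := 2 * a + 2 * (x + a + ipi)) (c := 2 * x + 2 * (2 * a)) (n := 1%Z)); last by rewrite /ZtoC; ring.
  rewrite theta_shift // /al /be.
  set t1 := theta _ (2 * a + 2 * x); set t2 := theta _ (2 * y); set t3 := theta _ (2 * x); set t4 := theta _ (2 * a + 2 * y).
  transitivity (cexp x * t1 * t2 + (cexp x * cexp (a + (x + a + ipi) + y) * cexp (- (2 * a + 2 * x))) * t3 * t4); first by ring.
  rewrite -!cexp_add.
  transitivity ((cexp (- (a / 2)) * cexp (a / 2 + x)) * t1 * t2 - (cexp (- (a / 2)) * cexp (a / 2 + y)) * t3 * t4); last by ring.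
  rewrite -!cexp_add.
  have -> : - (a / 2) + (a / 2 + x) = x by ring.
  have -> : - (a / 2) + (a / 2 + y) = y by ring.
  have -> : x + (a + (x + a + ipi) + y) + - (2 * a + 2 * x) = y + ipi by ring.
  rewrite (cexp_add y) cexp_ipi; ring.
rewrite !D; ring.
Qed.

(** * Products modulo 10 *)

Definition qp (q : C) (k m : nat) : C := qpoch_inf (q ^ k) (q ^ m).

Lemma qp_dissect (q : C) (n k m : nat) : (Cmod q < 1)%R -> (0 < m)%coq_nat -> (0 < n)%coq_nat ->
  qp q k m = \big[Cmult/RtoC 1]_(0 <= j < n) qp q (k + (m * j)%coq_nat)%coq_nat (m * n)%coq_nat.
Proof.
move=> q1 m0 n0; rewrite big_mkord /qp (qpoch_dissect _ (Cmod_pow_lt1 q1 m0) n0).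
by apply: eq_bigr => j _; rewrite Cpow_add_r !Cpow_mult_r.
Qed.

Lemma qp_pow (q : C) (n k m : nat) : qp (q ^ n) k m = qp q (n * k)%coq_nat (n * m)%coq_nat.
Proof. by rewrite /qp !Cpow_mult_r. Qed.

Lemma qp_neq0 (q : C) (k m : nat) : (Cmod q < 1)%R -> (0 < k)%coq_nat -> (0 < m)%coq_nat -> qp q k m <> 0.
Proof. by move=> q1 k0 m0; apply: qpoch_inf_neq0_small; apply: Cmod_pow_lt1. Qed.

(* The Rogers-Ramanujan continued fraction, without its factor [q^(1/5)]. *)
Definition rr (q : C) : C := qp q 1 5 * qp q 4 5 / (qp q 2 5 * qp q 3 5).

Section ThetaProducts.
Variable w : C.
Hypothesis w0 : (Re w < 0)%R.
Let q := cexp w.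

Let cexp_nat (n : nat) : cexp (INR n * w) = q ^ n.
Proof. exact: cexp_mult_nat. Qed.

(** The summand [ipi] cancels the signs inside [theta], and the shift by m/2 makes the two exponents
    [k] and [m - k]. *)
Lemma theta_qp (k m : nat) : (k <= m)%coq_nat ->
  theta (INR m / 2 * w) ((INR k - INR m / 2) * w + ipi) =
  qp q m m * (qp q k m * qp q (Nat.sub m k) m).
Proof.
move=> km; rewrite /theta /qp -!cexp_nat minus_INR // RtoC_minus.
have -> : 2 * (INR m / 2 * w) = INR m * w by field.
have -> : - cexp (INR m / 2 * w + ((INR k - INR m / 2) * w + ipi)) = cexp (INR k * w).
  have -> : INR m / 2 * w + ((INR k - INR m / 2) * w + ipi) = INR k * w + ipi by ring.
  by rewrite cexp_add cexp_ipi; ring.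
have -> : - cexp (INR m / 2 * w - ((INR k - INR m / 2) * w + ipi)) = cexp ((INR m - INR k) * w).
  have -> : INR m / 2 * w - ((INR k - INR m / 2) * w + ipi) = (INR m - INR k) * w - ipi by field.
  by rewrite /Cminus cexp_add cexp_opp cexp_ipi; field.
by [].
Qed.

Lemma theta_qp_neg (k m : nat) : (k <= m)%coq_nat ->
  theta (INR m / 2 * w) ((INR k - INR m / 2) * w) =
  qp q m m * (qpoch_inf (- q ^ k) (q ^ m) * qpoch_inf (- q ^ (Nat.sub m k)) (q ^ m)).
Proof.
move=> km; rewrite /theta /qp -!cexp_nat minus_INR // RtoC_minus.
have -> : 2 * (INR m / 2 * w) = INR m * w by field.
have -> : INR m / 2 * w + (INR k - INR m / 2) * w = INR k * w by ring.
have -> : INR m / 2 * w - (INR k - INR m / 2) * w = (INR m - INR k) * w by field.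
by [].
Qed.

Lemma qp_neg (k m : nat) : (0 < m)%coq_nat ->
  qp q k m * qpoch_inf (- q ^ k) (q ^ m) = qp q (2 * k)%coq_nat (2 * m)%coq_nat.
Proof.
move=> m0; rewrite /qp qpoch_mul_opp; last exact: Cmod_pow_lt1 (Cmod_cexp_lt1 w0) m0.
by rewrite -!Cpow_add_r; congr qpoch_inf; congr Cpow; lia.
Qed.

(** Stated with equations as premises, so that any argument congruent modulo 2 pi i can be
    recognised by [field]; integers pass through [Z.of_nat] because that form reduces to
    literals. *)
Lemma theta_qp_eq (k m : nat) (n : Z) (a b : C) : (k <= m)%coq_nat ->
  a = IZR (Z.of_nat m) / 2 * w ->
  b = (IZR (Z.of_nat k) - IZR (Z.of_nat m) / 2) * w + ipi + ZtoC n * (2 * ipi) ->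
  theta a b = qp q m m * (qp q k m * qp q (Nat.sub m k) m).
Proof. by rewrite -!INR_IZR_INZ => km -> /theta_period ->; apply: theta_qp. Qed.

Lemma theta_qp_neg_eq (k m : nat) (n : Z) (a b : C) : (k <= m)%coq_nat ->
  a = IZR (Z.of_nat m) / 2 * w ->
  b = (IZR (Z.of_nat k) - IZR (Z.of_nat m) / 2) * w + ZtoC n * (2 * ipi) ->
  theta a b =
  qp q m m * (qpoch_inf (- q ^ k) (q ^ m) * qpoch_inf (- q ^ (Nat.sub m k)) (q ^ m)).
Proof. by rewrite -!INR_IZR_INZ => km -> /theta_period ->; apply: theta_qp_neg. Qed.

End ThetaProducts.

Lemma otheta_opp (a b : C) : (Re a < 0)%R -> otheta a (- b) = - otheta a b.
Proof.
move=> a0; rewrite /otheta.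
have -> : - b + a + ipi = (- (b + a + ipi) + 2 * a) + 2 * ipi by ring.
rewrite (theta_period a (c := - (b + a + ipi) + 2 * a) (n := 1%Z)); last by rewrite /ZtoC; ring.
rewrite theta_shift // theta_even.
set t := theta _ _.
transitivity ((cexp (- b / 2) * cexp (- (a + - (b + a + ipi)))) * t); first by ring.
rewrite -cexp_add.
have -> : - b / 2 + - (a + - (b + a + ipi)) = b / 2 + ipi by field.
by rewrite cexp_add cexp_ipi; ring.
Qed.

Lemma Cdiv_neq_0 (x y : C) : x <> 0 -> y <> 0 -> x / y <> 0.
Proof.
move=> x0 y0 E; apply: x0; have -> : x = x / y * y by field.
by rewrite E; ring.
Qed.

(** * Relations of level 10 between theta products *)

Section ModTen.
Variable w : C.
Hypothesis w0 : (Re w < 0)%R.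
Let q := cexp w.
Let y := cexp (w / 2).
Let q1 : (Cmod q < 1)%R := Cmod_cexp_lt1 w0.

Let T (k : nat) := qp q k 10 * qp q (Nat.sub 10 k) 10.
Let P := qp q 10 10.
Let S := otheta (5 * w).

Let w5 : (Re (5 * w) < 0)%R.
Proof. by apply: Re_scal_neg; lra. Qed.

Let y0 : y <> 0.
Proof. exact: cexp_neq0. Qed.
Let yq : q = y * y.
Proof. by rewrite /q /y -cexp_add; congr cexp; field. Qed.
Let P0 : P <> 0.
Proof. by apply: qp_neq0 => //; lia. Qed.

(** Dictionary between the odd theta function at multiples of [w] and the products modulo 10. The
    power of [y], a square root of q, comes from the exponential in [otheta]; the sign is positive
    at negative multiples. *)
Let S_neg (k : nat) : (k <= 10)%coq_nat -> S (- (INR k * w)) = P * T k / y ^ k.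
Proof.
move=> hk; rewrite /S /otheta.
have -> : 5 * w = INR 10 / 2 * w by rewrite [INR 10]INR_IZR_INZ [Z.of_nat _]/=; field.
have -> : - (INR k * w) + INR 10 / 2 * w + ipi = (INR (Nat.sub 10 k) - INR 10 / 2) * w + ipi.
  by rewrite minus_INR // RtoC_minus; field.
rewrite theta_qp //; last lia.
have -> : Nat.sub 10 (Nat.sub 10 k) = k by lia.
have -> : cexp (- (INR k * w) / 2) = / y ^ k.
  by rewrite /y -cexp_mult_nat -cexp_opp; congr cexp; field.
rewrite -/q -/P /T; field; exact: Cpow_nz.
Qed.

Let S_pos (k : nat) : (k <= 10)%coq_nat -> S (INR k * w) = - (P * T k / y ^ k).
Proof. move=> hk; rewrite -S_neg // /S otheta_opp //; ring. Qed.

Let T_compl (k : nat) : (k <= 10)%coq_nat -> T (Nat.sub 10 k) = T k.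
Proof. by move=> hk; rewrite /T Cmult_comm; congr (_ * _); congr qp; lia. Qed.

Let T7 : T 7 = T 3. Proof. exact: (T_compl (k := 3) ltac:(lia)). Qed.
Let T6 : T 6 = T 4. Proof. exact: (T_compl (k := 4) ltac:(lia)). Qed.

Let Sn (k : nat) (z : C) : z = - (IZR (Z.of_nat k) * w) -> (k <= 10)%coq_nat -> S z = P * T k / y ^ k.
Proof. by rewrite -INR_IZR_INZ => ->; apply: S_neg. Qed.
Let Sp (k : nat) (z : C) : z = IZR (Z.of_nat k) * w -> (k <= 10)%coq_nat -> S z = - (P * T k / y ^ k).
Proof. by rewrite -INR_IZR_INZ => ->; apply: S_pos. Qed.

(** The arguments of the three-term relation are chosen so that, after division by
    [T 2 * T 3 ^ 2 * T 4], the left-hand side is 1 - k. *)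
Let rel1 : T 2 * T 3 ^ 2 * T 4 - q * T 1 * T 2 ^ 2 * T 3 = T 1 * T 4 ^ 2 * T 5.
Proof.
have := weierstrass_three_term (4 * w) (- (3) * w) (- (2) * w) (0 * w) w5.
cbv zeta; rewrite -/S.
rewrite (Sp (k := 1) (z := 4 * w + - (3) * w)); [|rewrite [Z.of_nat _]/=; field|lia].
rewrite (Sp (k := 7) (z := 4 * w - - (3) * w)); [|rewrite [Z.of_nat _]/=; field|lia].
rewrite (Sn (k := 2) (z := - (2) * w + 0 * w)); [|rewrite [Z.of_nat _]/=; field|lia].
rewrite (Sn (k := 2) (z := - (2) * w - 0 * w)); [|rewrite [Z.of_nat _]/=; field|lia].
rewrite (Sp (k := 2) (z := 4 * w + - (2) * w)); [|rewrite [Z.of_nat _]/=; field|lia].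
rewrite (Sp (k := 6) (z := 4 * w - - (2) * w)); [|rewrite [Z.of_nat _]/=; field|lia].
rewrite (Sn (k := 3) (z := - (3) * w + 0 * w)); [|rewrite [Z.of_nat _]/=; field|lia].
rewrite (Sn (k := 3) (z := - (3) * w - 0 * w)); [|rewrite [Z.of_nat _]/=; field|lia].
rewrite (Sp (k := 4) (z := 4 * w + 0 * w)); [|rewrite [Z.of_nat _]/=; field|lia].
rewrite (Sp (k := 4) (z := 4 * w - 0 * w)); [|rewrite [Z.of_nat _]/=; field|lia].
rewrite (Sn (k := 5) (z := - (3) * w + - (2) * w)); [|rewrite [Z.of_nat _]/=; field|lia].
rewrite (Sn (k := 1) (z := - (3) * w - - (2) * w)); [|rewrite [Z.of_nat _]/=; field|lia].
rewrite ?T7 ?T6 yq => E; apply: Csub_eq0.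
set L := (X in X = _) in E.
transitivity (- L * y ^ 14 / P ^ 4); first by rewrite /L; field.
by rewrite E; field.
Qed.

(** Half-integral arguments still have integral sums and differences. Division by
    [T 1 * T 3 * T 4 ^ 2] makes the left-hand side 1 + k. *)
Let rel2 : T 1 * T 3 * T 4 ^ 2 + q * T 1 ^ 2 * T 2 * T 4 = T 2 ^ 2 * T 3 * T 5.
Proof.
have := weierstrass_three_term (7 / 2 * w) (- (5) / 2 * w) (- (3) / 2 * w) (- (1) / 2 * w) w5.
cbv zeta; rewrite -/S.
rewrite (Sp (k := 1) (z := 7 / 2 * w + - (5) / 2 * w)); [|rewrite [Z.of_nat _]/=; field|lia].
rewrite (Sp (k := 6) (z := 7 / 2 * w - - (5) / 2 * w)); [|rewrite [Z.of_nat _]/=; field|lia].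
rewrite (Sn (k := 2) (z := - (3) / 2 * w + - (1) / 2 * w)); [|rewrite [Z.of_nat _]/=; field|lia].
rewrite (Sn (k := 1) (z := - (3) / 2 * w - - (1) / 2 * w)); [|rewrite [Z.of_nat _]/=; field|lia].
rewrite (Sp (k := 2) (z := 7 / 2 * w + - (3) / 2 * w)); [|rewrite [Z.of_nat _]/=; field|lia].
rewrite (Sp (k := 5) (z := 7 / 2 * w - - (3) / 2 * w)); [|rewrite [Z.of_nat _]/=; field|lia].
rewrite (Sn (k := 3) (z := - (5) / 2 * w + - (1) / 2 * w)); [|rewrite [Z.of_nat _]/=; field|lia].
rewrite (Sn (k := 2) (z := - (5) / 2 * w - - (1) / 2 * w)); [|rewrite [Z.of_nat _]/=; field|lia].
rewrite (Sp (k := 3) (z := 7 / 2 * w + - (1) / 2 * w)); [|rewrite [Z.of_nat _]/=; field|lia].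
rewrite (Sp (k := 4) (z := 7 / 2 * w - - (1) / 2 * w)); [|rewrite [Z.of_nat _]/=; field|lia].
rewrite (Sn (k := 4) (z := - (5) / 2 * w + - (3) / 2 * w)); [|rewrite [Z.of_nat _]/=; field|lia].
rewrite (Sn (k := 1) (z := - (5) / 2 * w - - (3) / 2 * w)); [|rewrite [Z.of_nat _]/=; field|lia].
rewrite ?T7 ?T6 yq => E; apply: Csub_eq0.
set L := (X in X = _) in E.
transitivity (L * y ^ 12 / P ^ 4); first by rewrite /L; field.
by rewrite E; field.
Qed.

(** This is what turns (1 + k) - k^2 into a single product, once 1 + k is known. *)
Let rel3 : T 3 ^ 3 * T 5 - q ^ 2 * T 1 ^ 3 * T 3 = T 2 * T 4 ^ 3.
Proof.
have := weierstrass_three_term (4 * w) (1 * w) (3 * w) (0 * w) w5.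
cbv zeta; rewrite -/S.
rewrite (Sp (k := 5) (z := 4 * w + 1 * w)); [|rewrite [Z.of_nat _]/=; field|lia].
rewrite (Sp (k := 3) (z := 4 * w - 1 * w)); [|rewrite [Z.of_nat _]/=; field|lia].
rewrite (Sp (k := 3) (z := 3 * w + 0 * w)); [|rewrite [Z.of_nat _]/=; field|lia].
rewrite (Sp (k := 3) (z := 3 * w - 0 * w)); [|rewrite [Z.of_nat _]/=; field|lia].
rewrite (Sp (k := 7) (z := 4 * w + 3 * w)); [|rewrite [Z.of_nat _]/=; field|lia].
rewrite (Sp (k := 1) (z := 4 * w - 3 * w)); [|rewrite [Z.of_nat _]/=; field|lia].
rewrite (Sp (k := 1) (z := 1 * w + 0 * w)); [|rewrite [Z.of_nat _]/=; field|lia].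
rewrite (Sp (k := 1) (z := 1 * w - 0 * w)); [|rewrite [Z.of_nat _]/=; field|lia].
rewrite (Sp (k := 4) (z := 4 * w + 0 * w)); [|rewrite [Z.of_nat _]/=; field|lia].
rewrite (Sp (k := 4) (z := 4 * w - 0 * w)); [|rewrite [Z.of_nat _]/=; field|lia].
rewrite (Sp (k := 4) (z := 1 * w + 3 * w)); [|rewrite [Z.of_nat _]/=; field|lia].
rewrite (Sn (k := 2) (z := 1 * w - 3 * w)); [|rewrite [Z.of_nat _]/=; field|lia].
rewrite ?T7 ?T6 yq => E; apply: Csub_eq0.
set L := (X in X = _) in E.
transitivity (L * y ^ 14 / P ^ 4); first by rewrite /L; field.
by rewrite E; field.
Qed.

Let T0 (k : nat) : (0 < k)%coq_nat -> (k < 10)%coq_nat -> T k <> 0.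
Proof. by move=> h1 h2; apply: Cmult_neq_0; apply: qp_neq0 => //; lia. Qed.

Let T10 : T 1 <> 0. Proof. by apply: T0; lia. Qed.
Let T20 : T 2 <> 0. Proof. by apply: T0; lia. Qed.
Let T30 : T 3 <> 0. Proof. by apply: T0; lia. Qed.
Let T40 : T 4 <> 0. Proof. by apply: T0; lia. Qed.
Let T50 : T 5 <> 0. Proof. by apply: T0; lia. Qed.

Let rrE : rr q = T 1 * T 4 / (T 2 * T 3).
Proof.
have d k : qp q k 5 = qp q k 10 * qp q (k + 5)%coq_nat 10.
  rewrite (@qp_dissect q 2) //; try lia.
  rewrite unlock /= Cmult_1_r; congr (qp _ _ _ * qp _ _ _); lia.
rewrite /rr !d /T /=; field.
by repeat split; apply: qp_neq0 => //; lia.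
Qed.

Let rr2E : rr (q ^ 2) = T 2 / T 4.
Proof. by rewrite /rr !qp_pow /T /=; field; repeat split; apply: qp_neq0 => //; lia. Qed.

Let k := q * rr q * rr (q ^ 2) ^ 2.
Let kE : k = q * T 1 * T 2 / (T 3 * T 4).
Proof. by rewrite /k rrE rr2E; field. Qed.

Let subk : 1 - k = T 1 * T 4 * T 5 / (T 2 * T 3 ^ 2).
Proof.
have -> : T 1 * T 4 * T 5 / (T 2 * T 3 ^ 2) = T 1 * T 4 ^ 2 * T 5 / (T 2 * T 3 ^ 2 * T 4) by field.
by rewrite -rel1 kE; field.
Qed.

Let addk : 1 + k = T 2 ^ 2 * T 5 / (T 1 * T 4 ^ 2).
Proof.
have -> : T 2 ^ 2 * T 5 / (T 1 * T 4 ^ 2) = T 2 ^ 2 * T 3 * T 5 / (T 1 * T 3 * T 4 ^ 2) by field.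
by rewrite -rel2 kE; field.
Qed.

Let quadk : 1 + k - k ^ 2 = T 2 ^ 3 * T 4 / (T 1 * T 3 ^ 3).
Proof.
have -> : T 2 ^ 3 * T 4 / (T 1 * T 3 ^ 3) = T 2 ^ 2 * (T 2 * T 4 ^ 3) / (T 1 * T 3 ^ 3 * T 4 ^ 2) by field.
by rewrite -rel3 addk kE; field.
Qed.

(** Each of the four quantities is a quotient of convergent products without zero factors. These
    facts justify every later division. *)
Lemma level10_k_neq0 : k <> 0 /\ 1 - k <> 0 /\ 1 + k <> 0 /\ 1 + k - k ^ 2 <> 0.
Proof.
have q0 : q <> 0 by exact: cexp_neq0.
rewrite quadk subk addk kE.
by repeat first [assumption | split | apply: Cdiv_neq_0 | apply: Cpow_nz | apply: Cmult_neq_0].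
Qed.

Lemma level10_rr : rr q ^ 2 * (1 + k) = rr (q ^ 2) * (1 - k).
Proof. by rewrite addk subk rrE rr2E; field. Qed.

(** The product part of [U], that is, [U] without its factor q^(1/2). *)
Let v := qp q 1 10 * qp q 9 10 * (qp q 3 10 * qp q 7 10) /
  (qp q 4 10 * qp q 6 10 * (qp q 2 10 * qp q 8 10)).
Let vE : v = T 1 * T 3 / (T 4 * T 2).
Proof. by []. Qed.

Lemma level10_hauptmodul : q * v ^ 2 * (1 + k - k ^ 2) = k.
Proof. by rewrite quadk kE vE; field. Qed.

(** Rewrites [U] in terms of Euler products, the form to which the 5-dissection applies. *)
Lemma level10_eta_quotient :
  v = qp q 1 1 * qp q 10 10 ^ 2 / (qp q 2 2 ^ 2 * qp q 5 5).
Proof.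
have h5 : qp q 5 10 <> 0 by apply: qp_neq0 => //; lia.
have d1 : qp q 1 1 = T 1 * T 2 * T 3 * T 4 * qp q 5 10 * P.
  rewrite (@qp_dissect q 10) //; try lia.
  rewrite unlock /= /T /P /=; ring.
have d2 : qp q 2 2 = T 2 * T 4 * P.
  rewrite (@qp_dissect q 5) //; try lia.
  rewrite unlock /= /T /P /=; ring.
have d5 : qp q 5 5 = qp q 5 10 * P.
  rewrite (@qp_dissect q 2) //; try lia.
  rewrite unlock /= /T /P /=; ring.
by rewrite vE d1 d2 d5 -/P; field.
Qed.

End ModTen.

(** * The 5-dissection of Euler's product *)

Section EulerDissection.
Variable w : C.
Hypothesis w0 : (Re w < 0)%R.
Let x := cexp w.
Let x1 : (Cmod x < 1)%R := Cmod_cexp_lt1 w0.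

(** The pentagonal number series: its exponents are (3 n^2 - n) / 2. *)
Let euler_theta : qp x 1 1 = theta (3 / 2 * w) (- (1) / 2 * w + ipi).
Proof.
rewrite (@theta_qp_eq w 1 3 0%Z); last first.
- by rewrite /ZtoC [Z.of_nat 1]/= [Z.of_nat 3]/=; field.
- by rewrite [Z.of_nat _]/=; field.
- lia.
rewrite (@qp_dissect x 3) //; try lia.
rewrite -/x unlock /=; ring.
Qed.

Let qpn (k m : nat) := qpoch_inf (- x ^ k) (x ^ m).

(** The quintuple product with a = 25w/2. Its common factor [theta (6 * a)] is (x^50;x^50) split
    modulo 3, which cancels against the same factor of [theta (2 * a)]. *)
Let piece (k : nat) (z : C) : (k = 5 \/ k = 10)%nat -> z = IZR (Z.of_nat k) * w + ipi ->
  theta (75 / 2 * w) (3 * z - 25 / 2 * w) - cexp z * theta (75 / 2 * w) (3 * z + 25 / 2 * w) =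
  qp x 25 25 * (qpn k 25 * qpn (Nat.sub 25 k) 25) *
  (qp x (Nat.sub 25 (2 * k)%coq_nat) 50 * qp x (25 + (2 * k)%coq_nat)%coq_nat 50).
Proof.
move=> hk zE; have a0 : (Re (25 / 2 * w) < 0)%R.
  by have -> : 25 / 2 = RtoC (25 / 2) by [rewrite RtoC_div]; apply: Re_scal_neg; lra.
have := quintuple_product z a0.
rewrite (@theta_qp_neg_eq w k 25 1%Z); last first.
- by rewrite zE /ZtoC [Z.of_nat 25]/=; field.
- by rewrite [Z.of_nat _]/=; field.
- lia.
rewrite (@theta_qp_eq w (25 + (2 * k)%coq_nat)%coq_nat 50 1%Z); last first.
- rewrite zE Nat2Z.inj_add Nat2Z.inj_mul plus_IZR mult_IZR RtoC_plus RtoC_mult.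
  by rewrite /ZtoC [Z.of_nat 25]/= [Z.of_nat 50]/= [Z.of_nat 2]/=; field.
- by rewrite [Z.of_nat _]/=; field.
- lia.
rewrite (@theta_qp_eq w 100 150 0%Z); last first.
- by rewrite /ZtoC [Z.of_nat 100]/= [Z.of_nat 150]/=; field.
- by rewrite [Z.of_nat _]/=; field.
- lia.
have -> : 3 * (25 / 2 * w) = 75 / 2 * w by field.
have -> : Nat.sub 50 (25 + (2 * k)%coq_nat)%coq_nat = Nat.sub 25 (2 * k)%coq_nat by lia.
have d50 : qp x 50 50 = qp x 150 150 * (qp x 100 150 * qp x (Nat.sub 150 100) 150).
  rewrite (@qp_dissect x 3) //; try lia.
  rewrite unlock /=; ring.
rewrite -/x -d50 => E.
have h0 : qp x 50 50 <> 0 by apply: qp_neq0 => //; lia.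
set L := (X in X = _).
have -> : L = qp x 50 50 * L / qp x 50 50 by field.
by rewrite -E /qpn -/x; field.
Qed.

(** In the pentagonal series split modulo 5, class 1 is the Euler product in x^25, while classes 0
    and 2, and classes 3 and 4, pair up into quintuple products; these give 1/R and R. *)
Lemma euler_dissect5 :
  qp x 1 1 = qp x 25 25 * (/ rr (x ^ 5) - x - x ^ 2 * rr (x ^ 5)).
Proof.
have a0 : (Re (3 / 2 * w) < 0)%R.
  by have -> : 3 / 2 = RtoC (3 / 2) by [rewrite RtoC_div]; apply: Re_scal_neg; lra.
have a75 : (Re (75 / 2 * w) < 0)%R.
  by have -> : 75 / 2 = RtoC (75 / 2) by [rewrite RtoC_div]; apply: Re_scal_neg; lra.
rewrite euler_theta theta_dissect5 //.
have cx (n : nat) (z : C) (m : Z) : z = IZR (Z.of_nat n) * w + ZtoC m * (2 * ipi) -> cexp z = x ^ n.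
  by move=> ->; rewrite cexp_add cexp_2ipi_Z -INR_IZR_INZ cexp_mult_nat Cmult_1_r.
have cxo (n : nat) (z : C) (m : Z) : z = IZR (Z.of_nat n) * w + ipi + ZtoC m * (2 * ipi) -> cexp z = - x ^ n.
  by move=> ->; rewrite !cexp_add cexp_2ipi_Z cexp_ipi -INR_IZR_INZ cexp_mult_nat -/x; ring.
pose Th (c : C) := theta (75 / 2 * w) (c / 2 * w + ipi).
have th (b c : C) (n : Z) : b = c / 2 * w + ipi + ZtoC n * (2 * ipi) -> theta (75 / 2 * w) b = Th c.
  by move=> /theta_period ->.
have q5 : Th 5 + x ^ 5 * Th 55 =
    qp x 25 25 * (qpn 5 25 * qpn 20 25) * (qp x 15 50 * qp x 35 50).
  rewrite -(piece (k := 5) (z := 5 * w + ipi)) //; last by left.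
  rewrite (cxo 5%nat _ 0%Z); last by rewrite /ZtoC [Z.of_nat _]/=; ring.
  rewrite (th (3 * _ - _) 5 1%Z); last by rewrite /ZtoC; field.
  rewrite (th (3 * _ + _) 55 1%Z); last by rewrite /ZtoC; field.
  ring.
have q10 : Th 35 + x ^ 10 * Th 85 =
    qp x 25 25 * (qpn 10 25 * qpn 15 25) * (qp x 5 50 * qp x 45 50).
  rewrite -(piece (k := 10) (z := 10 * w + ipi)) //; last by right.
  rewrite (cxo 10%nat _ 0%Z); last by rewrite /ZtoC [Z.of_nat _]/=; ring.
  rewrite (th (3 * _ - _) 35 1%Z); last by rewrite /ZtoC; field.
  rewrite (th (3 * _ + _) 85 1%Z); last by rewrite /ZtoC; field.
  ring.
have -> : 25 * (3 / 2 * w) = 75 / 2 * w by field.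
have b0 : theta (75 / 2 * w) (5 * (- (1) / 2 * w + ipi)) = Th 5.
  by rewrite -theta_even; apply: (th _ 5 (-3)%Z); rewrite /ZtoC; field.
have b1 : theta (75 / 2 * w) (5 * (- (1) / 2 * w + ipi) + 10 * (3 / 2 * w)) = qp x 25 25.
  rewrite (@theta_qp_eq w 50 75 2%Z); last first.
  - by rewrite /ZtoC [Z.of_nat 50]/= [Z.of_nat 75]/=; field.
  - by rewrite [Z.of_nat _]/=; field.
  - lia.
  rewrite -/x (@qp_dissect x 3 25 25) //; try lia.
  rewrite unlock /=; ring.
have b2 : theta (75 / 2 * w) (5 * (- (1) / 2 * w + ipi) + 20 * (3 / 2 * w)) = Th 55.
  by apply: (th _ 55 2%Z); rewrite /ZtoC; field.
have b3 : theta (75 / 2 * w) (5 * (- (1) / 2 * w + ipi) + 30 * (3 / 2 * w)) = Th 85.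
  by apply: (th _ 85 2%Z); rewrite /ZtoC; field.
(* The argument of class 4 lies a full quasi-period away; shifting back and using evenness gives
   [Th 35], at the cost of the factor -x^(-20). *)
have b4 : theta (75 / 2 * w) (5 * (- (1) / 2 * w + ipi) + 40 * (3 / 2 * w)) = - / x ^ 20 * Th 35.
  have -> : 5 * (- (1) / 2 * w + ipi) + 40 * (3 / 2 * w) =
    (- (35) / 2 * w + 5 * ipi) + 2 * (75 / 2 * w) by field.
  rewrite theta_shift // -theta_even (th _ 35 (-3)%Z); last by rewrite /ZtoC; field.
  rewrite cexp_opp (cxo 20%nat _ 2%Z); last by rewrite /ZtoC [Z.of_nat _]/=; field.
  field; exact: cexp_neq0.
rewrite b0 b1 b2 b3 b4.
rewrite (cxo 1%nat (3 / 2 * w + _) 0%Z); last by rewrite /ZtoC [Z.of_nat _]/=; field.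
rewrite (cx 5%nat (4 * _ + _) 1%Z); last by rewrite /ZtoC [Z.of_nat _]/=; field.
rewrite (cxo 12%nat (9 * _ + _) 1%Z); last by rewrite /ZtoC [Z.of_nat _]/=; field.
rewrite (cx 22%nat (16 * _ + _) 2%Z); last by rewrite /ZtoC [Z.of_nat _]/=; field.
have x0 : x <> 0 by exact: cexp_neq0.
transitivity ((Th 5 + x ^ 5 * Th 55) - x * qp x 25 25 - x ^ 2 * (Th 35 + x ^ 10 * Th 85)).
  by field.
rewrite q5 q10.
have n25 k : (0 < k)%coq_nat -> qp x k 25 <> 0 by move=> h; apply: qp_neq0 => //; lia.
have ng k : (0 < k)%coq_nat -> qpn k 25 = qp x (2 * k)%coq_nat 50 / qp x k 25.
  move=> h; rewrite -[50%nat]/(2 * 25)%coq_nat -qp_neg //; last lia.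
  rewrite -/x -/(qpn k 25); field; exact: n25.
have d k : qp x k 25 = qp x k 50 * qp x (k + 25)%coq_nat 50.
  rewrite (@qp_dissect x 2 k 25) //; try lia.
  rewrite unlock /= Cmult_1_r; congr (qp _ _ _ * qp _ _ _); lia.
rewrite !ng; try lia.
have -> : rr (x ^ 5) = qp x 5 25 * qp x 20 25 / (qp x 10 25 * qp x 15 25) by rewrite /rr !qp_pow.
have -> : / (qp x 5 25 * qp x 20 25 / (qp x 10 25 * qp x 15 25)) =
  (qp x 10 50 * qp x 35 50) * (qp x 15 50 * qp x 40 50) / (qp x 5 25 * qp x 20 25).
  by rewrite -(d 10%nat) -(d 15%nat); field; repeat split; apply: n25; lia.
have -> : qp x 5 25 * qp x 20 25 / (qp x 10 25 * qp x 15 25) =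
  (qp x 5 50 * qp x 30 50) * (qp x 20 50 * qp x 45 50) / (qp x 10 25 * qp x 15 25).
  by rewrite -(d 5%nat) -(d 20%nat).
by rewrite /=; field; repeat split; apply: n25; lia.
Qed.

End EulerDissection.

(** * The Rogers-Ramanujan fraction and the sixth power of the Euler quotient *)

Definition zeta5 : C := cexp (2 * ipi / 5).

Lemma zeta5_sum : 1 + zeta5 + zeta5 ^ 2 + zeta5 ^ 3 + zeta5 ^ 4 = 0.
Proof.
have z5 : zeta5 ^ 5 = 1.
  rewrite /zeta5 -cexp_mult_nat INR_IZR_INZ [Z.of_nat _]/= -cexp_2ipi; congr cexp; field.
(* The real part of [zeta5] is cos(2 pi / 5), strictly less than cos 0. *)
have z1 : zeta5 - 1 <> 0.
  move=> E; have {E} : Re zeta5 = 1%R.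
    by have -> : zeta5 = (zeta5 - 1) + 1 by [ring]; rewrite E /Re /=; ring.
  have -> : zeta5 = cexp (RtoC (2 * PI / 5) * ci).
    by congr cexp; rewrite /ipi RtoC_div; try lra; rewrite RtoC_mult; field.
  rewrite /cexp /Re /Im /= !Rmult_0_r !Rmult_0_l Rmult_1_r Rminus_0_r Rplus_0_r.
  rewrite exp_0 Rmult_1_l -cos_0 => E.
  have pi := PI_RGT_0.
  have := cos_decreasing_1 0 (2 * PI / 5) ltac:(lra) ltac:(lra) ltac:(lra) ltac:(lra) ltac:(lra); lra.
set S := (X in X = _).
have -> : S = (zeta5 ^ 5 - 1) / (zeta5 - 1) by rewrite /S; field.
by rewrite z5; field.
Qed.

(** The dissection is applied at the five fifth roots x of q. There R(x^5) and (x^25;x^25) depend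
    only on x^5 = q, so the conjugates differ only in the powers of x in the bracket. *)
Lemma rr_eta_sixth (w : C) : (Re w < 0)%R -> let q := cexp w in
  rr q <> 0 /\ qp q 1 1 ^ 6 = qp q 5 5 ^ 6 * (/ rr q ^ 5 - 11 * q - q ^ 2 * rr q ^ 5).
Proof.
move=> w0 q; have q1 : (Cmod q < 1)%R := Cmod_cexp_lt1 w0.
have R0 : rr q <> 0.
  by apply: Cdiv_neq_0; apply: Cmult_neq_0; apply: qp_neq0 => //; lia.
split=> //; set R := rr q in R0 *.
pose x := cexp (w / 5); pose z := zeta5.
have Rez : Re (ZtoC 1 * ipi) = 0%R by rewrite /ipi /ci /ZtoC /Re /=; ring.
(* Adding 2 pi i j / 5 to the logarithm leaves the real part unchanged, so the dissection is valid
   at every conjugate. *)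
have w5 (j : nat) : (Re (w / 5 + INR j * (2 * ipi / 5)) < 0)%R.
  have -> : w / 5 + INR j * (2 * ipi / 5) = RtoC (1 / 5) * w + RtoC (INR j * 2 / 5) * (ZtoC 1 * ipi).
    by rewrite !RtoC_div; try lra; rewrite RtoC_mult /ZtoC; field.
  move: w0 Rez; set i1 := ZtoC 1 * ipi; rewrite /Re /= => *; nra.
have xj j : cexp (w / 5 + INR j * (2 * ipi / 5)) = z ^ j * x.
  by rewrite cexp_add cexp_mult_nat Cmult_comm.
have x5 : x ^ 5 = q.
  by rewrite /x -cexp_mult_nat INR_IZR_INZ [Z.of_nat _]/=; congr cexp; field.
have z5 : z ^ 5 = 1.
  rewrite /z /zeta5 -cexp_mult_nat INR_IZR_INZ [Z.of_nat _]/= -cexp_2ipi; congr cexp; field.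
have zx5 j : (z ^ j * x) ^ 5 = q.
  by rewrite Cpow_mult_l -Cpow_mult_r Nat.mul_comm Cpow_mult_r z5 Cpow_1_l x5 Cmult_1_l.
have dis j : qpoch_inf (z ^ j * x) (z ^ j * x) =
    qp q 5 5 * (/ R - z ^ j * x - (z ^ j * x) ^ 2 * R).
  have := euler_dissect5 (w5 j); rewrite xj zx5 -/R.
  have -> : qp (z ^ j * x) 25 25 = qp q 5 5 by rewrite -(zx5 j) qp_pow.
  by rewrite /qp !Cpow_1_r.
have x1 : (Cmod x < 1)%R.
  by have := Cmod_cexp_lt1 (w5 0%nat); rewrite xj /= Cmult_1_l.
have := qpoch_conjugates zeta5_sum x1; cbv beta zeta; rewrite -/z !dis.
have -> : qpoch_inf (x ^ 25) (x ^ 25) = qp q 5 5 by rewrite -x5 qp_pow /qp.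
rewrite x5; have -> : qpoch_inf q q = qp q 1 1 by rewrite /qp !Cpow_1_r.
move=> <-.
pose t := x * R.
have z4 : z ^ 4 = - (1 + z + z ^ 2 + z ^ 3).
  have -> : z ^ 4 = - (1 + z + z ^ 2 + z ^ 3) + (1 + z + z ^ 2 + z ^ 3 + z ^ 4) by ring.
  rewrite /z zeta5_sum; ring.
(* 1 - t - t^2 has reciprocal roots alpha, beta with sum 1 and product -1, so the norm is (1 -
   alpha^5 t^5)(1 - beta^5 t^5); 11 is the Lucas number alpha^5 + beta^5. *)
have key : (1 - z ^ 0 * t - (z ^ 0 * t) ^ 2) * (1 - z ^ 1 * t - (z ^ 1 * t) ^ 2) *
   (1 - z ^ 2 * t - (z ^ 2 * t) ^ 2) * (1 - z ^ 3 * t - (z ^ 3 * t) ^ 2) *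
   (1 - z ^ 4 * t - (z ^ 4 * t) ^ 2) = 1 - 11 * t ^ 5 - t ^ 10 by ring [z5 z4].
have fac j : / R - z ^ j * x - (z ^ j * x) ^ 2 * R = (1 - z ^ j * t - (z ^ j * t) ^ 2) / R.
  by rewrite /t; move: (z ^ j) => zj; field.
rewrite !fac.
transitivity (qp q 5 5 ^ 6 * ((1 - z ^ 0 * t - (z ^ 0 * t) ^ 2) * (1 - z ^ 1 * t - (z ^ 1 * t) ^ 2) *
   (1 - z ^ 2 * t - (z ^ 2 * t) ^ 2) * (1 - z ^ 3 * t - (z ^ 3 * t) ^ 2) *
   (1 - z ^ 4 * t - (z ^ 4 * t) ^ 2)) / R ^ 5).
  move: (1 - z ^ 0 * t - (z ^ 0 * t) ^ 2) (1 - z ^ 1 * t - (z ^ 1 * t) ^ 2) (1 - z ^ 2 * t - (z ^ 2 * t) ^ 2)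
   (1 - z ^ 3 * t - (z ^ 3 * t) ^ 2) (1 - z ^ 4 * t - (z ^ 4 * t) ^ 2) => a0 a1 a2 a3 a4.
  by field.
by rewrite key /t -x5; field.
Qed.

(** * The quintic relation *)

(** An element of Q(k)(r) by its coordinates in the basis 1, ..., r^4; [poly4_mul] reduces with r^5
    = rho. Equality of coordinates is enough for every identity below. *)
Definition poly4 (r a0 a1 a2 a3 a4 : C) : C :=
  a0 + a1 * r + a2 * r ^ 2 + a3 * r ^ 3 + a4 * r ^ 4.

Lemma poly4_mul (r rho a0 a1 a2 a3 a4 b0 b1 b2 b3 b4 : C) : r ^ 5 = rho ->
  poly4 r a0 a1 a2 a3 a4 * poly4 r b0 b1 b2 b3 b4 =
  poly4 r (a0 * b0 + rho * (a1 * b4 + a2 * b3 + a3 * b2 + a4 * b1))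
    (a0 * b1 + a1 * b0 + rho * (a2 * b4 + a3 * b3 + a4 * b2))
    (a0 * b2 + a1 * b1 + a2 * b0 + rho * (a3 * b4 + a4 * b3))
    (a0 * b3 + a1 * b2 + a2 * b1 + a3 * b0 + rho * (a4 * b4))
    (a0 * b4 + a1 * b3 + a2 * b2 + a3 * b1 + a4 * b0).
Proof. by move=> H; rewrite /poly4; ring [H]. Qed.

Lemma poly4_add (r a0 a1 a2 a3 a4 b0 b1 b2 b3 b4 : C) :
  poly4 r a0 a1 a2 a3 a4 + poly4 r b0 b1 b2 b3 b4 =
  poly4 r (a0 + b0) (a1 + b1) (a2 + b2) (a3 + b3) (a4 + b4).
Proof. rewrite /poly4; ring. Qed.

Lemma poly4_scal (r c a0 a1 a2 a3 a4 : C) :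
  c * poly4 r a0 a1 a2 a3 a4 = poly4 r (c * a0) (c * a1) (c * a2) (c * a3) (c * a4).
Proof. rewrite /poly4; ring. Qed.

Section Quintic.
Variables k r : C.
Let B := 1 + k - k ^ 2.
Let rho := k * (1 - k) ^ 2 / (1 + k) ^ 2.
Hypotheses (k0 : k <> 0) (k1 : 1 - k <> 0) (k2 : 1 + k <> 0) (B0 : B <> 0) (r0 : r <> 0).
Hypothesis r5 : r ^ 5 = rho.

(* The solution of [W * D^2 = N] in the field Q(k)(r), found by linear algebra. *)
Let W := poly4 r
      (k * (1 - 3 * k - k ^ 2 + 3 * k ^ 3 + k ^ 4) / (B ^ 3))
      (k * (1 + k) * (- (2) + 2 * k + k ^ 2 + k ^ 3) / (B ^ 3))
      (k * (1 + k) * (3 + 2 * k + k ^ 2 + k ^ 3) / (B ^ 3))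
      ((1 + k) ^ 2 * (1 - k + 2 * k ^ 2 - 3 * k ^ 3) / ((1 - k) * B ^ 3))
      ((1 + k) ^ 2 * (- (1) + k - 2 * k ^ 2 - 2 * k ^ 3) / ((1 - k) * B ^ 3)).
(** The reduced coordinates of W^2 and, next, of W^4 are written out so that each power is verified
    by one multiplication and five identities in [k]. *)
Let W2 := poly4 r
      (k ^ 2 * (11 - 16 * k + 17 * k ^ 2 + 12 * k ^ 3 - 55 * k ^ 4 - 12 * k ^ 5 + 17 * k ^ 6 + 16 * k ^ 7 + 11 * k ^ 8) / (B ^ 6))
      (k * (1 + k) * (1 - 11 * k + 27 * k ^ 2 - 23 * k ^ 3 - 30 * k ^ 4 + 8 * k ^ 5 + 7 * k ^ 6 + 21 * k ^ 7 + 6 * k ^ 8) / (B ^ 6))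
      (k * (1 + k) * (- (2) + 12 * k - 24 * k ^ 2 - 24 * k ^ 3 + 10 * k ^ 4 + 9 * k ^ 5 + 31 * k ^ 6 + 23 * k ^ 7 + 3 * k ^ 8) / (B ^ 6))
      (k * (1 + k) ^ 2 * (3 - 23 * k + 31 * k ^ 2 - 9 * k ^ 3 + 10 * k ^ 4 + 24 * k ^ 5 - 24 * k ^ 6 - 12 * k ^ 7 - 2 * k ^ 8) / ((1 - k) * B ^ 6))
      (k * (1 + k) ^ 2 * (- (6) + 21 * k - 7 * k ^ 2 + 8 * k ^ 3 + 30 * k ^ 4 - 23 * k ^ 5 - 27 * k ^ 6 - 11 * k ^ 7 - k ^ 8) / ((1 - k) * B ^ 6)).
Let W4 := poly4 r
      (k ^ 3 * (- (24) + 459 * k - 1948 * k ^ 2 + 3612 * k ^ 3 - 340 * k ^ 4 - 7251 * k ^ 5 + 6976 * k ^ 6 - 4012 * k ^ 7 - 5792 * k ^ 8 + 14385 * k ^ 9 + 5792 * k ^ 10 - 4012 * k ^ 11 - 6976 * k ^ 12 - 7251 * k ^ 13 + 340 * k ^ 14 + 3612 * k ^ 15 + 1948 * k ^ 16 + 459 * k ^ 17 + 24 * k ^ 18) / (B ^ 12))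
      (k ^ 3 * (1 + k) * (55 - 655 * k + 2605 * k ^ 2 - 4225 * k ^ 3 + 775 * k ^ 4 + 4545 * k ^ 5 - 9245 * k ^ 6 + 5645 * k ^ 7 + 8650 * k ^ 8 - 1850 * k ^ 9 - 1340 * k ^ 10 - 7160 * k ^ 11 - 4840 * k ^ 12 + 2100 * k ^ 13 + 3100 * k ^ 14 + 1560 * k ^ 15 + 290 * k ^ 16 + 10 * k ^ 17) / (B ^ 12))
      (k ^ 2 * (1 + k) * (1 - 101 * k + 847 * k ^ 2 - 2423 * k ^ 3 + 1535 * k ^ 4 + 1949 * k ^ 5 - 6489 * k ^ 6 + 5893 * k ^ 7 + 7718 * k ^ 8 - 1490 * k ^ 9 - 1308 * k ^ 10 - 8932 * k ^ 11 - 8761 * k ^ 12 + 1129 * k ^ 13 + 5215 * k ^ 14 + 3937 * k ^ 15 + 1378 * k ^ 16 + 174 * k ^ 17 + 4 * k ^ 18) / (B ^ 12))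
      (k ^ 2 * (1 + k) ^ 2 * (- (4) + 174 * k - 1378 * k ^ 2 + 3937 * k ^ 3 - 5215 * k ^ 4 + 1129 * k ^ 5 + 8761 * k ^ 6 - 8932 * k ^ 7 + 1308 * k ^ 8 - 1490 * k ^ 9 - 7718 * k ^ 10 + 5893 * k ^ 11 + 6489 * k ^ 12 + 1949 * k ^ 13 - 1535 * k ^ 14 - 2423 * k ^ 15 - 847 * k ^ 16 - 101 * k ^ 17 - k ^ 18) / ((1 - k) * B ^ 12))
      (k ^ 2 * (1 + k) ^ 2 * (10 - 290 * k + 1560 * k ^ 2 - 3100 * k ^ 3 + 2100 * k ^ 4 + 4840 * k ^ 5 - 7160 * k ^ 6 + 1340 * k ^ 7 - 1850 * k ^ 8 - 8650 * k ^ 9 + 5645 * k ^ 10 + 9245 * k ^ 11 + 4545 * k ^ 12 - 775 * k ^ 13 - 4225 * k ^ 14 - 2605 * k ^ 15 - 655 * k ^ 16 - 55 * k ^ 17) / ((1 - k) * B ^ 12)).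

Let W2E : W * W = W2.
Proof. by rewrite /W (poly4_mul _ _ _ _ _ _ _ _ _ _ r5) /W2 /rho; congr poly4; rewrite /B; field. Qed.

Let W4E : W2 * W2 = W4.
Proof. by rewrite /W2 (poly4_mul _ _ _ _ _ _ _ _ _ _ r5) /W4 /rho; congr poly4; rewrite /B; field. Qed.

(** The relation R(q)^2 (1 + k) = R(q^2) (1 - k) in the variables r = q R(q^5) and s = q^2 R(q^10),
    with [k] taken at q^5. *)
Let s := r ^ 2 * (1 + k) / (1 - k).
Let D := poly4 r
      ((- (1)))
      (0)
      ((1 + k) * (- (1)) / ((1 - k)))
      ((1 + k) / (k * (1 - k)))
      (0).
Let D2 := poly4 r
      ((- (1)))
      ((1) / (k))
      ((1 + k) * (2) / ((1 - k)))
      ((1 + k) * (- (2)) / (k * (1 - k)))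
      ((1 + k) ^ 2 / ((1 - k) ^ 2)).
Let N := poly4 r
      ((- (1)))
      ((- (1)))
      (0)
      (0)
      ((1 + k) ^ 2 / (k * (1 - k) ^ 2)).

Let DE : / s - 1 - s = D.
Proof.
(* Inverses are cleared with r^5 = rho: 1 / r^2 = r^3 / rho. *)
have -> : / s = r ^ 3 * (1 + k) / (k * (1 - k)).
  have -> : r ^ 3 * (1 + k) / (k * (1 - k)) = r ^ 5 * (1 + k) / (r ^ 2 * k * (1 - k)) by field.
  by rewrite r5 /s /rho; field.
by rewrite /s /D /poly4; field.
Qed.

Let NE : / r - 1 - r = N.
Proof.
have -> : / r = r ^ 4 * (1 + k) ^ 2 / (k * (1 - k) ^ 2).
  have -> : r ^ 4 * (1 + k) ^ 2 / (k * (1 - k) ^ 2) = r ^ 5 * (1 + k) ^ 2 / (r * k * (1 - k) ^ 2) by field.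
  by rewrite r5 /rho; field.
by rewrite /N /poly4; field.
Qed.

Let D2E : D * D = D2.
Proof. by rewrite /D (poly4_mul _ _ _ _ _ _ _ _ _ _ r5) /D2 /rho; congr poly4; field. Qed.

Let WD2 : W * D2 = N.
Proof. by rewrite /W /D2 (poly4_mul _ _ _ _ _ _ _ _ _ _ r5) /N /rho; congr poly4; rewrite /B; field. Qed.

Let v := k / B.

Let quintic_W : W * (W4 / v ^ 2 + 5 * W2 * (5 * v - 3) + 5 * v)
  - v * (1 + 5 * (W2 / v) * ((5 * v ^ 2 - 5 * v + 1) * (W2 / v) + 3 * v - 1)) = 0.
Proof.
have v0 : v <> 0 by apply: Cdiv_neq_0.
(* Powers are grouped so that a single product of two elements of the field remains; the rest is
   linear in the coordinates of [W2] and [W4]. *)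
transitivity (W * (/ v ^ 2 * W4 + 5 * (5 * v - 3) * W2 + poly4 r (5 * v) 0 0 0 0) +
  (- (5 * (5 * v ^ 2 - 5 * v + 1) / v) * W4 + - (5 * (3 * v - 1)) * W2 + poly4 r (- v) 0 0 0 0)).
  by rewrite -W4E /poly4; field.
rewrite /W /W4 /W2 !poly4_scal !poly4_add (poly4_mul _ _ _ _ _ _ _ _ _ _ r5) !poly4_add.
transitivity (poly4 r 0 0 0 0 0); last by rewrite /poly4; ring.
by congr poly4; rewrite /rho /v /B; field.
Qed.

(* [W] stands for [U(tau) U(5 tau)], [r] and [s] for the Rogers-Ramanujan continued
   fraction at [5 tau] and [10 tau], and [v] for [U(5 tau)^2]. *)
Lemma quintic_relation (w0 : C) : / s - 1 - s <> 0 ->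
  w0 * (/ s - 1 - s) ^ 2 = / r - 1 - r ->
  w0 * (w0 ^ 4 / v ^ 2 + 5 * w0 ^ 2 * (5 * v - 3) + 5 * v)
  - v * (1 + 5 * (w0 ^ 2 / v) * ((5 * v ^ 2 - 5 * v + 1) * (w0 ^ 2 / v) + 3 * v - 1)) = 0.
Proof.
rewrite DE NE => D0 Hw; have D20 : D2 <> 0 by rewrite -D2E; apply: Cmult_neq_0.
(* [W] solves the same linear equation, whose coefficient [D2] is nonzero, so [w0] is forced to
   equal it. *)
have -> : w0 = W.
  have -> : w0 = w0 * D ^ 2 / D2 by rewrite -D2E; field.
  by rewrite Hw -WD2; field.
have -> : W ^ 2 = W2 by rewrite -W2E; ring.
have -> : W ^ 4 = W4 by rewrite -W4E -W2E; ring.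
exact: quintic_W.
Qed.

End Quintic.

(** * The functions g and U *)

Definition prodU (q : C) : C :=
  qp q 1 10 * qp q 9 10 * (qp q 3 10 * qp q 7 10) /
  (qp q 4 10 * qp q 6 10 * (qp q 2 10 * qp q 8 10)).

(** No power of q stands in front: the exponents of q^(1/24) in [g] add up to 2*2 + 4*5 - 4*1 - 2*10
    = 0. *)
Definition prodg (q : C) : C :=
  qp q 2 2 ^ 2 * qp q 5 5 ^ 4 / (qp q 1 1 ^ 4 * qp q 10 10 ^ 2).

Section Moebius.
Variable w : C.
Hypothesis w0 : (Re w < 0)%R.
Let q := cexp w.
Let q1 : (Cmod q < 1)%R := Cmod_cexp_lt1 w0.
Let a := rr q.
Let b := rr (q ^ 2).
Let k := q * a * b ^ 2.
Let u := q * prodU q ^ 2.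

Let q0 : q <> 0. Proof. exact: cexp_neq0. Qed.

Let w2 : (Re (2 * w) < 0)%R. Proof. by apply: Re_scal_neg; lra. Qed.
Let q2E : cexp (2 * w) = q ^ 2.
Proof. by rewrite /q -cexp_mult_nat INR_IZR_INZ. Qed.

Let a0 : a <> 0. Proof. exact: (proj1 (rr_eta_sixth w0)). Qed.
Let b0 : b <> 0. Proof. by have := proj1 (rr_eta_sixth w2); rewrite q2E. Qed.

(** Write q a^5 = q a (a^2)^2, substitute a^2 = b (1 - k) / (1 + k), and recognise k = q a b^2. *)
Lemma rr_fifth : q * a ^ 5 = k * (1 - k) ^ 2 / (1 + k) ^ 2.
Proof.
have [k0 [k1 [k2 B0]]] := level10_k_neq0 w0; have := level10_rr w0.
rewrite -/q -/a -/b -/k in k0 k1 k2 B0 * => H.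
have -> : q * a ^ 5 = q * a * (a ^ 2 * (1 + k)) ^ 2 / (1 + k) ^ 2 by field.
rewrite H; transitivity ((q * a * b ^ 2) * (1 - k) ^ 2 / (1 + k) ^ 2); last by [].
by field.
Qed.

(** Here one factor b of q^2 b^5 is replaced by a^2 (1 + k) / (1 - k), and q^2 a^2 b^4 = k^2. *)
Lemma rr2_fifth : q ^ 2 * b ^ 5 = k ^ 2 * (1 + k) / (1 - k).
Proof.
have [k0 [k1 [k2 B0]]] := level10_k_neq0 w0; have := level10_rr w0.
rewrite -/q -/a -/b -/k in k0 k1 k2 B0 * => H.
have -> : q ^ 2 * b ^ 5 = q ^ 2 * b ^ 4 * (b * (1 - k)) / (1 - k) by field.
rewrite -H; transitivity ((q * a * b ^ 2) ^ 2 * (1 + k) / (1 - k)); last by [].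
by field.
Qed.

Lemma prodg_moebius : 1 - 5 * u <> 0 /\ prodg q * (1 - 5 * u) = 1 - u.
Proof.
have [k0 [k1 [k2 B0]]] := level10_k_neq0 w0.
have Hu := level10_hauptmodul w0.
have [_ E1] := rr_eta_sixth w0; have [_ E2] := rr_eta_sixth w2.
have e1 := rr_fifth; have e2 := rr2_fifth; have Hv := level10_eta_quotient w0.
rewrite q2E in E2; rewrite (qp_pow q 2 1 1 : _ = qp q 2 2) (qp_pow q 2 5 5 : _ = qp q 10 10) in E2.
rewrite -/q -/a -/b -/k -/(prodU q) -/u in k0 k1 k2 B0 Hu E1 E2 Hv *.
set B := 1 + k - k ^ 2 in B0 Hu.
pose A := 1 - 4 * k - k ^ 2.
have uE : u = k / B by rewrite -Hu; field.
have n1 : qp q 1 1 <> 0 by apply: qp_neq0 => //; lia.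
have n2 : qp q 2 2 <> 0 by apply: qp_neq0 => //; lia.
have n5 : qp q 5 5 <> 0 by apply: qp_neq0 => //; lia.
have n10 : qp q 10 10 <> 0 by apply: qp_neq0 => //; lia.
have {E1} E1 : qp q 1 1 ^ 6 = qp q 5 5 ^ 6 * (q * (A ^ 2 * B / (k * (1 - k) ^ 2 * (1 + k) ^ 2))).
  rewrite E1; congr (_ * _).
  have -> : / a ^ 5 - 11 * q - q ^ 2 * a ^ 5 = q * (/ (q * a ^ 5) - 11 - q * a ^ 5) by field.
  by rewrite e1 /A /B; field.
have {E2} E2 : qp q 2 2 ^ 6 = qp q 10 10 ^ 6 * (q ^ 2 * (A * B ^ 2 / (k ^ 2 * (1 - k) * (1 + k)))).
  rewrite E2; congr (_ * _).
  have -> : / b ^ 5 - 11 * q ^ 2 - (q ^ 2) ^ 2 * b ^ 5 = q ^ 2 * (/ (q ^ 2 * b ^ 5) - 11 - q ^ 2 * b ^ 5) by field.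
  by rewrite e2 /A /B; field.
(* [A] divides the sixth power of an Euler product without zeros, so it cannot vanish; this later
   gives 1 - 5u = A/B nonzero. *)
have A0 : A <> 0.
  move=> h; apply: (Cpow_nz _ 6 n1); rewrite E1 h; field; by repeat split.
have gE : prodg q = (1 - k ^ 2) / A.
  (* By the Euler-product form of [prodU], g is U^2 times the sixth power of the level-5 quotient at
     q^2 divided by that at q; both sixth powers are known in [k]. *)
  have -> : prodg q = u / q * (qp q 2 2 ^ 6 / qp q 10 10 ^ 6) / (qp q 1 1 ^ 6 / qp q 5 5 ^ 6).
    by rewrite /u Hv /prodg; field.
  by rewrite E1 E2 uE; field.
rewrite gE uE; have -> : 1 - 5 * (k / B) = A / B by rewrite /A /B; field.
split; first exact: Cdiv_neq_0.
by rewrite /B; field.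
Qed.
End Moebius.

(** [h] plays q^(1/2), so X and Y are U(tau) and U(5 tau). The relation is sorted by parity, with
    the terms odd in X on the left and those odd in Y on the right, so that squaring leaves only X^2
    and Y^2. *)
Lemma U_relation (w h : C) : (Re w < 0)%R -> let q := cexp w in h ^ 2 = q ->
  let X := h * prodU q in let Y := h ^ 5 * prodU (q ^ 5) in
  Y <> 0 /\
  X * (X ^ 4 + 5 * X ^ 2 * Y ^ 2 * (5 * Y ^ 2 - 3) + 5 * Y ^ 2) =
  Y * (1 + 5 * X ^ 2 * ((5 * Y ^ 4 - 5 * Y ^ 2 + 1) * X ^ 2 + 3 * Y ^ 2 - 1)).
Proof.
move=> w0 q hq X Y.
have q1 : (Cmod q < 1)%R := Cmod_cexp_lt1 w0.
have q0 : q <> 0 by exact: cexp_neq0.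
have w5 : (Re (5 * w) < 0)%R by apply: Re_scal_neg; lra.
have w2 : (Re (2 * w) < 0)%R by apply: Re_scal_neg; lra.
have q5E : cexp (5 * w) = q ^ 5 by rewrite /q -cexp_mult_nat INR_IZR_INZ.
have q2E : cexp (2 * w) = q ^ 2 by rewrite /q -cexp_mult_nat INR_IZR_INZ.
have [k0 [k1 [k2 B0]]] := level10_k_neq0 w5.
have HV : cexp (5 * w) * prodU (cexp (5 * w)) ^ 2 * _ = _ := level10_hauptmodul w5.
have Hr5 := rr_fifth w5; have Hrr := level10_rr w5.
have [a0 _] := rr_eta_sixth w5.
have f1 := euler_dissect5 w0; have f2 := euler_dissect5 w2.
have vX : prodU q = _ := level10_eta_quotient w0.
have vY : prodU (cexp (5 * w)) = _ := level10_eta_quotient w5.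
rewrite q5E in k0 k1 k2 B0 HV Hr5 Hrr a0 vY.
rewrite q2E in f2.
have pw : (q ^ 2) ^ 5 = (q ^ 5) ^ 2 by ring.
rewrite pw in f2; rewrite -/q in f1 vX.
set a := rr (q ^ 5) in k0 k1 k2 B0 HV Hr5 Hrr a0 f1.
set b := rr ((q ^ 5) ^ 2) in k0 k1 k2 B0 HV Hr5 Hrr f2.
set k := q ^ 5 * a * b ^ 2 in k0 k1 k2 B0 HV Hr5 Hrr.
rewrite (qp_pow q 2 1 1 : _ = qp q 2 2) (qp_pow q 2 25 25 : _ = qp q 50 50) in f2.
rewrite (qp_pow q 5 1 1 : _ = qp q 5 5) (qp_pow q 5 2 2 : _ = qp q 10 10)
  (qp_pow q 5 5 5 : _ = qp q 25 25) (qp_pow q 5 10 10 : _ = qp q 50 50) in vY.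
have n k' : (0 < k')%coq_nat -> qp q k' k' <> 0 by move=> hk; apply: qp_neq0.
have n1 := n 1%nat ltac:(lia); have n2 := n 2%nat ltac:(lia); have n5 := n 5%nat ltac:(lia).
have n10 := n 10%nat ltac:(lia); have n25 := n 25%nat ltac:(lia); have n50 := n 50%nat ltac:(lia).
have h0 : h <> 0 by move=> h0; apply: q0; rewrite -hq h0; ring.
have b0 : b <> 0 by move=> b0; apply: k0; rewrite /k b0; ring.
have Y0 : Y <> 0.
  rewrite /Y vY.
  by repeat first [assumption | apply: Cdiv_neq_0 | apply: Cpow_nz | apply: Cmult_neq_0].
split=> //.
pose r := q * a; pose s := q ^ 2 * b.
have r0 : r <> 0 by apply: Cmult_neq_0.
have sE : s = r ^ 2 * (1 + k) / (1 - k).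
  have -> : r ^ 2 * (1 + k) = q ^ 2 * (a ^ 2 * (1 + k)) by rewrite /r; ring.
  by rewrite Hrr /s; field.
have r5 : r ^ 5 = k * (1 - k) ^ 2 / (1 + k) ^ 2 by rewrite -Hr5 /r; ring.
have f2' : qp q 2 2 = qp q 50 50 * (q ^ 2 * (/ s - 1 - s)) by rewrite f2 /s; field.
have f1' : qp q 1 1 = qp q 25 25 * (q * (/ r - 1 - r)) by rewrite f1 /r; field.
have D0 : / s - 1 - s <> 0 by move=> D0; apply: n2; rewrite f2' D0; ring.
have Y2 : Y ^ 2 = k / (1 + k - k ^ 2).
  have -> : Y ^ 2 = (h ^ 2) ^ 5 * prodU (q ^ 5) ^ 2 by rewrite /Y; ring.
  have -> : (h ^ 2) ^ 5 * prodU (q ^ 5) ^ 2 = q ^ 5 * prodU (q ^ 5) ^ 2 * (1 + k - k ^ 2) / (1 + k - k ^ 2).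
    by rewrite hq; field.
  by rewrite HV.
(* The half-integral powers combine to h^6 = q^3 and the Euler products in q^5 and q^10 cancel. What
   remains are the quotients (q;q)/(q^25;q^25) and (q^2;q^2)/(q^50;q^50) given by the dissection at
   q and q^2. *)
have XY : X * Y = q ^ 3 * (qp q 1 1 * qp q 50 50 ^ 2 / (qp q 2 2 ^ 2 * qp q 25 25)).
  have -> : q ^ 3 = h ^ 6 by rewrite -hq; ring.
  by rewrite /X /Y vX vY; field.
have HW : X * Y * (/ s - 1 - s) ^ 2 = / r - 1 - r.
  rewrite XY f1' f2'; set D := / s - 1 - s in D0 *; set N := / r - 1 - r.
  by field.
rewrite sE in D0 HW.
have := quintic_relation k0 k1 k2 B0 r0 r5 D0 HW; rewrite -Y2.
move=> H; apply: Csub_eq0.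
set E := (X in X = _).
(* Multiplication by Y replaces X by X Y and leaves only Y^2 besides, the shape of
   [quintic_relation]. *)
have -> : E = (Y * E) / Y by field.
set F := (X in X = _) in H.
have -> : Y * E = F by rewrite /E /F; field.
by rewrite H; field.
Qed.

(** * From products back to the functions of tau, and the two relations *)

Lemma qpow_cexp (r : R) (tau : C) : qpow r tau = cexp (r * (2 * PI * ci * tau)).
Proof. by rewrite /qpow !RtoC_mult; congr cexp; ring. Qed.

Lemma Re_nome (tau : C) : (0 < Im tau)%R -> (Re (2 * PI * ci * tau) < 0)%R.
Proof. by rewrite /ci /Re /Im /= => h; have := PI_RGT_0; nra. Qed.

Section Functions.
Variable tau : C.
Hypothesis Htau : (0 < Im tau)%R.
Let w := 2 * PI * ci * tau.
Let q := cexp w.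
Let w0 : (Re w < 0)%R := Re_nome Htau.
Let q1 : (Cmod q < 1)%R := Cmod_cexp_lt1 w0.

Let qpow_nat (n : nat) : qpow (IZR (Z.of_nat n)) tau = q ^ n.
Proof. by rewrite qpow_cexp -INR_IZR_INZ cexp_mult_nat. Qed.

Let etaE (n : nat) : Defs.eta (IZR (Z.of_nat n) * tau) = cexp (w / 24) ^ n * qp q n n.
Proof.
rewrite /Defs.eta /qp -!cexp_mult_nat !qpow_cexp INR_IZR_INZ.
have -> : RtoC 1 * (2 * PI * ci * (IZR (Z.of_nat n) * tau)) = IZR (Z.of_nat n) * w by rewrite /w; ring.
congr (cexp _ * _); rewrite RtoC_div; try lra; rewrite /w; field.
Qed.

Lemma g_prodg : g tau = prodg q.
Proof.
rewrite /g (etaE 2) (etaE 5) (etaE 10).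
have -> : Defs.eta tau = cexp (w / 24) ^ 1 * qp q 1 1.
  by rewrite -etaE; congr Defs.eta; rewrite [Z.of_nat _]/=; ring.
have t0 : cexp (w / 24) <> 0 by exact: cexp_neq0.
rewrite /prodg; field; repeat split => //; apply: qp_neq0 => //; lia.
Qed.

Lemma U_prodU : U tau = qpow (1 / 2) tau * prodU q.
Proof.
rewrite /U /I_fun /J_fun /prodU.
have -> : qpow (3 / 4) tau = qpow (1 / 4) tau * qpow (1 / 2) tau.
  rewrite !qpow_cexp -cexp_add -Cmult_plus_distr_r -RtoC_plus.
  by have -> : (1 / 4 + 1 / 2 = 3 / 4)%R by field.
have t0 : qpow (1 / 4) tau <> 0 by rewrite qpow_cexp; exact: cexp_neq0.
rewrite (qpow_nat 1) (qpow_nat 2) (qpow_nat 3) (qpow_nat 4) (qpow_nat 6) (qpow_nat 7)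
  (qpow_nat 8) (qpow_nat 9) (qpow_nat 10).
rewrite -!/(qp _ _ _); field.
by repeat split => //; apply: qp_neq0 => //; lia.
Qed.

End Functions.

(* Clearing denominators, the left-hand side is [1024 * (u * A^2 - v * B^2)]. *)
Lemma moebius_quintic (u v X Y : C) : 1 - 5 * u <> 0 -> 1 - 5 * v <> 0 ->
  X * (1 - 5 * u) = 1 - u -> Y * (1 - 5 * v) = 1 - v ->
  u * (u ^ 2 + 5 * u * v * (5 * v - 3) + 5 * v) ^ 2 =
  v * (1 + 5 * u * ((5 * v ^ 2 - 5 * v + 1) * u + 3 * v - 1)) ^ 2 ->
  X ^ 5 - Y - 5 * X * Y * polyP X Y = 25 * X ^ 2 * Y ^ 2 * polyQ X Y.
Proof.
move=> u0 v0 HX HY H; apply: Csub_eq0.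
have -> : X = (1 - u) / (1 - 5 * u) by rewrite -HX; field.
have -> : Y = (1 - v) / (1 - 5 * v) by rewrite -HY; field.
set L := u * _ in H; set M := v * _ in H.
transitivity (1024 * (L - M) / ((1 - 5 * u) ^ 5 * (1 - 5 * v) ^ 5)).
  by rewrite /L /M /polyP /polyQ; field.
by rewrite H; field.
Qed.

Theorem theorem4p6 (tau : C) (Htau : (0 < Im tau)%R) :
  (Cpow (g tau) 5 - g (RtoC 5 * tau)
     - RtoC 5 * g tau * g (RtoC 5 * tau) * polyP (g tau) (g (RtoC 5 * tau))
   = RtoC 25 * Cpow (g tau) 2 * Cpow (g (RtoC 5 * tau)) 2
       * polyQ (g tau) (g (RtoC 5 * tau)))
  /\
  (Cpow (U tau) 5 - U (RtoC 5 * tau)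
   = RtoC 5 * U tau * U (RtoC 5 * tau) * polyR (U tau) (U (RtoC 5 * tau))).
Proof.
have Htau5 : (0 < Im (RtoC 5 * tau))%R by rewrite /Im /=; move: Htau; rewrite /Im; lra.
set w := 2 * PI * ci * tau.
have w0 : (Re w < 0)%R := Re_nome Htau.
have w5 : (Re (5 * w) < 0)%R by apply: Re_scal_neg; lra.
have w5E : 2 * PI * ci * (5 * tau) = 5 * w by rewrite /w; ring.
set q := cexp w.
have q5E : cexp (5 * w) = q ^ 5 by rewrite /q -cexp_mult_nat INR_IZR_INZ.
set h := qpow (1 / 2) tau.
have hq : h ^ 2 = q.
  rewrite /h qpow_cexp -/w -cexp_mult_nat INR_IZR_INZ [Z.of_nat _]/= RtoC_div; try lra.
  by congr cexp; field.
have h5 : qpow (1 / 2) (5 * tau) = h ^ 5.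
  rewrite /h !qpow_cexp w5E -cexp_mult_nat INR_IZR_INZ [Z.of_nat _]/=.
  by congr cexp; rewrite /w; ring.
have [] := U_relation w0 hq.
have [u0 gX] := prodg_moebius w0; have [v0 gY] := prodg_moebius w5.
rewrite q5E in v0 gY.
rewrite (g_prodg Htau) (g_prodg Htau5) (U_prodU Htau) (U_prodU Htau5) w5E -/w -/q q5E -/h h5.
rewrite -/q in u0 gX.
set X := h * prodU q; set Y := h ^ 5 * prodU (q ^ 5) => Y0 E.
have uE : q * prodU q ^ 2 = X ^ 2 by rewrite -{1}hq /X; ring.
have vE : q ^ 5 * prodU (q ^ 5) ^ 2 = Y ^ 2 by rewrite -{1}hq /Y; ring.
rewrite uE in u0 gX; rewrite vE in v0 gY.
split; last first.
  apply: Csub_eq0; rewrite /polyR.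
  set L := X * _ in E; set M := Y * _ in E.
  transitivity (L - M); first by rewrite /L /M; ring.
  by rewrite E; ring.
(* With u = X^2 and v = Y^2 the remaining goal is exactly the square of the relation [E]. *)
apply: moebius_quintic u0 v0 gX gY _.
set L := X * _ in E; set M := Y * _ in E.
transitivity (L ^ 2); first by rewrite /L; ring.
by rewrite E /M; ring.
Qed.
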